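(* For every $s\in(-1,1)$ there is a constant $c'>0$ (depending only on $s$) such that the following holds for every positive integer $m$, with $\delta=sm\in(-m,m)$. Let $G\sim \mathrm{PA}_n^{(m,\delta)}$ and let $\tilde G$ be the $n$-vertex simple graph obtained from $G$ by removing loops and multiple edges (i.e. $uv\in E(\tilde G)$, $u\neq v$, if and only if $G$ has at least one edge between $u$ and $v$). Then, with probability tending to $1$ as $n\to\infty$, $\tilde G$ has average degree $2m(1-o(1))$ and $$q^*(\tilde G)\ \ge\ c'\,m^{-1/2}.$$
   Context: Modularity: for a simple graph $G$ with $M\ge 1$ edges and a partition $\mathcal P$ of $V(G)$, $q_{\mathcal P}(G)=\sum_{S\in\mathcal P}\left(\frac{e(S)}{M}-\left(\frac{\mathrm{vol}(S)}{2M}\right)^2\right)$, where $e(S)$ is the number of edges inside $S$ and $\mathrm{vol}(S)$ is the sum of the degrees (in $G$) of vertices of $S$; $q^*(G)=\max_{\mathcal P}q_{\mathcal P}(G)$ over all partitions of $V(G)$. Preferential attachment model $\mathrm{PA}_n^{(m,\delta)}$ (as in van der Hofstad's book ''Random Graphs and Complex Networks''; the full definition is given here), for a positive integer $m$ and real $\delta>-m$. In multigraphs, degrees count each loop twice. Case $m=1$, $\delta>-1$: $\mathrm{PA}_1^{(1,\delta)}$ is a single vertex $v_1$ with one loop. Given $\mathrm{PA}_t^{(1,\delta)}$ on vertices $v_1,\dots,v_t$, with $D_i(t)$ the degree of $v_i$, the graph $\mathrm{PA}_{t+1}^{(1,\delta)}$ is obtained by adding a vertex $v_{t+1}$ with one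 edge, whose other endpoint is $v_{t+1}$ itself with probability $\frac{1+\delta}{t(2+\delta)+(1+\delta)}$ and is $v_i$, $i\in\{1,\dots,t\}$, with probability $\frac{D_i(t)+\delta}{t(2+\delta)+(1+\delta)}$. General $m$: $\mathrm{PA}_n^{(m,\delta)}$ is obtained from $\mathrm{PA}_{mn}^{(1,\delta/m)}$ by merging, for each $j\in\{1,\dots,n\}$, the $m$ vertices $v_{(j-1)m+1},\dots,v_{jm}$ into a single vertex $v_j$, keeping all edges (so loops and multiple edges may occur). The resulting multigraph has $n$ vertices and $mn$ edges, and its first vertex has $m$ loops. *)

(* Defs.v *)
From HB Require Import structures.
From mathcomp Require Import all_boot all_order all_algebra.
From mathcomp Require Import reals.

Set Implicit Arguments.
Unset Strict Implicit.
Unset Printing Implicit Defensive.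

Import Order.TTheory GRing.Theory Num.Theory.
Local Open Scope ring_scope.

Record simple_graph (V : finType) := SimpleGraph {
  adj :> rel V;
  adj_sym : symmetric adj;
  adj_irr : irreflexive adj }.

Section Modularity.
Variables (R : realType) (V : finType) (G : simple_graph V).

Definition edges : {set {set V}} :=
  [set [set p.1; p.2] | p : V * V & G p.1 p.2].

Definition edges_in (S : {set V}) : {set {set V}} :=
  [set E in edges | E \subset S].

Definition deg (v : V) : nat := #|[set u | G v u]|.

Definition vol (S : {set V}) : nat := (\sum_(v in S) deg v)%N.

Definition avg_degree : R := (\sum_(v : V) deg v)%:R / #|V|%:R.

(* Division by zero makes this 0 when G has no edge. *)
Definition modularity (P : {set {set V}}) : R :=
  \sum_(S in P) (#|edges_in S|%:R / #|edges|%:R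
                 - ((vol S)%:R / (2 * #|edges|%:R)) ^+ 2).

Definition singletons : {set {set V}} := [set [set v] | v : V].

(* The maximum is over a nonempty finite set of partitions; the default value
   of the iterated maximum is the value at one of them. *)
Definition max_modularity : R :=
  \big[Order.max/modularity singletons]_(P : {set {set V}} |
     partition P [set: V]) modularity P.

Lemma singletons_partition : partition singletons [set: V].
Proof.
have -> : singletons = preim_partition id [set: V].
  apply/setP => A; apply/imsetP/imsetP => -[v _ ->]; exists v => //;
  by apply/setP => u; rewrite !inE eq_sym.
exact: preim_partitionP.
Qed.

Lemma max_modularity_ge (P : {set {set V}}) :
  partition P [set: V] -> modularity P <= max_modularity.
Proof. by move=> PV; apply: le_bigmax_cond. Qed.

Lemma max_modularity_attained :
  exists2 P, partition P [set: V] & max_modularity = modularity P.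
Proof.
rewrite /max_modularity; elim/big_ind: _ => [|x y xP yP|P PV].
- by exists singletons => //; exact: singletons_partition.
- by rewrite /Order.max; case: ifP.
- by exists P.
Qed.

End Modularity.

(* A finite multigraph is the list of its edges. The orientation of the pairs
   is immaterial, and (v, v) is a loop at v. *)
Definition multigraph (V : finType) := seq (V * V).

Section Multigraph.
Variable V : finType.
Implicit Type G : multigraph V.

Definition mdeg G (v : V) : nat :=
  (count (fun e : V * V => e.1 == v) G + count (fun e : V * V => e.2 == v) G)%N.

Definition map_vertices (W : finType) (f : V -> W) G : multigraph W :=
  [seq (f e.1, f e.2) | e <- G].

Definition simplify_rel G : rel V :=
  [rel u v | (u != v) && (((u, v) \in (G : seq _)) || ((v, u) \in (G : seq _)))].

Lemma simplify_sym G : symmetric (simplify_rel G).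
Proof. by move=> u v; rewrite /simplify_rel /= eq_sym orbC. Qed.

Lemma simplify_irr G : irreflexive (simplify_rel G).
Proof. by move=> u; rewrite /simplify_rel /= eqxx. Qed.

Definition simplify G : simple_graph V :=
  SimpleGraph (simplify_sym G) (simplify_irr G).

Lemma sum_mdeg G : (\sum_(v : V) mdeg G v = 2 * size G)%N.
Proof.
have sum_count (f : V * V -> V) :
    (\sum_v count (fun e => f e == v) G = size G)%N.
  elim: G => [|e G IH] /=; first by rewrite big1.
  rewrite big_split /= IH (bigD1 (f e)) //= eqxx big1 ?addn0 // => v.
  by rewrite eq_sym => /negbTE ->.
by rewrite big_split /= !sum_count mul2n addnn.
Qed.

End Multigraph.

(* PA_t^(1,a): the vertices v_1, ..., v_t are the elements 0, ..., t - 1 of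
   'I_t. An element of [history t] records the successive choices of endpoint;
   when v_{t+1} arrives the choice is None for v_{t+1} itself and Some i for
   the older vertex i. Since v_1 can only choose itself, the recursion may
   start from the empty graph: for t = 0 the formula of [attach_prob] gives
   None probability 1. *)
Fixpoint history (t : nat) : finType :=
  match t with
  | 0 => unit : finType
  | u.+1 => (history u * option 'I_u)%type : finType
  end.

Definition add_vertex (t : nat) (G : multigraph 'I_t) (c : option 'I_t) :
    multigraph 'I_t.+1 :=
  (ord_max, if c is Some i then lift ord_max i else ord_max)
    :: map_vertices (lift ord_max) G.

Fixpoint pa1_graph (t : nat) : history t -> multigraph 'I_t :=
  match t with
  | 0 => fun _ => [::]
  | u.+1 => fun h => add_vertex (pa1_graph h.1) h.2
  end.

Definition attach_prob (R : realType) (a : R) (t : nat) (G : multigraph 'I_t)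
    (c : option 'I_t) : R :=
  (if c is Some i then (mdeg G i)%:R + a else 1 + a)
    / (t%:R * (2 + a) + (1 + a)).

Fixpoint pa1_pmf (R : realType) (a : R) (t : nat) : history t -> R :=
  match t with
  | 0 => fun _ => 1
  | u.+1 => fun h => pa1_pmf a h.1 * attach_prob a (pa1_graph h.1) h.2
  end.

Lemma merge_subproof (m n : nat) (k : 'I_(m * n)) : (k %/ m < n)%N.
Proof.
case: m k => [|m] [k /= lt_k]; first by rewrite mul0n in lt_k.
by rewrite ltn_divLR // mulnC.
Qed.

Definition merge (m n : nat) (k : 'I_(m * n)) : 'I_n :=
  Ordinal (merge_subproof k).

Definition pa_graph (m n : nat) (h : history (m * n)) : multigraph 'I_n :=
  map_vertices (@merge m n) (pa1_graph h).

(* The probability that G ~ PA_n^(m,d) satisfies A. *)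
Definition pa_prob (R : realType) (m : nat) (d : R) (n : nat)
    (A : pred (multigraph 'I_n)) : R :=
  \sum_(h : history (m * n) | A (pa_graph h)) pa1_pmf (d / m%:R) h.

Lemma mdeg_add_vertex_new (t : nat) (G : multigraph 'I_t) c :
  mdeg (add_vertex G c) ord_max = (if c is Some _ then 1%N else 2%N).
Proof.
rewrite /mdeg /= eqxx !count_map !(eq_count (a2 := pred0)) ?count_pred0.
- by case: c => [i|] /=; rewrite ?eqxx // eq_sym (negbTE (neq_lift _ _)).
- by move=> e /=; rewrite eq_sym (negbTE (neq_lift _ _)).
- by move=> e /=; rewrite eq_sym (negbTE (neq_lift _ _)).
Qed.

Lemma mdeg_add_vertex_old (t : nat) (G : multigraph 'I_t) c (i : 'I_t) :
  mdeg (add_vertex G c) (lift ord_max i) = (mdeg G i + (c == Some i))%N.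
Proof.
have lift_eq (j : 'I_t) : (lift ord_max j == lift ord_max i) = (j == i).
  exact: inj_eq lift_inj _ _.
have max_eq : (ord_max == lift ord_max i) = false by exact/negbTE/neq_lift.
rewrite /mdeg /= max_eq !count_map add0n addnCA addnC.
congr ((_ + _) + _)%N; try by apply: eq_count => e /=; exact: lift_eq.
by case: c => [j|] //=; rewrite ?lift_eq ?max_eq.
Qed.

Lemma mdeg_pa1_gt0 (t : nat) (h : history t) i : (0 < mdeg (pa1_graph h) i)%N.
Proof.
elim: t h i => [|t IH] h i; first by case: i.
case: (unliftP ord_max i) => [j|] -> /=.
  by rewrite mdeg_add_vertex_old addn_gt0 IH.
by rewrite mdeg_add_vertex_new; case: h.2.
Qed.

Lemma size_pa1_graph (t : nat) (h : history t) : size (pa1_graph h) = t.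
Proof. by elim: t h => //= t IH h; rewrite size_map IH. Qed.

Lemma size_pa_graph (m n : nat) (h : history (m * n)) :
  size (pa_graph h) = (m * n)%N.
Proof. by rewrite size_map size_pa1_graph. Qed.

Section Normalization.
Variables (R : realType) (a : R) (a_gt : -1 < a).

Let a1_gt0 : 0 < 1 + a.
Proof. by rewrite -ltrBlDl sub0r. Qed.

Let den_gt0 (t : nat) : 0 < t%:R * (2 + a) + (1 + a).
Proof.
rewrite ltr_wpDl // mulr_ge0 // -lerBlDl sub0r ltW //.
by rewrite (lt_trans _ a_gt) // ltrN2 ltr1n.
Qed.

Lemma attach_prob_ge0 (t : nat) (h : history t) c :
  0 <= attach_prob a (pa1_graph h) c.
Proof.
apply: divr_ge0; last exact/ltW/den_gt0.
case: c => [i|]; last exact: ltW.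
by apply: le_trans (ltW a1_gt0) _; rewrite lerD2r ler1n mdeg_pa1_gt0.
Qed.

Lemma attach_prob_sum1 (t : nat) (h : history t) :
  \sum_c attach_prob a (pa1_graph h) c = 1.
Proof.
rewrite -mulr_suml (bigD1 None) //=.
rewrite (reindex_omap Some id) /=; last by case.
under eq_bigl do rewrite eqxx.
rewrite big_split /= -natr_sum sum_mdeg size_pa1_graph sumr_const card_ord.
rewrite natrM -[a *+ t]mulr_natl [2 * _]mulrC -mulrDr addrC.
by rewrite divff // gt_eqF // den_gt0.
Qed.

Lemma pa1_pmf_ge0 (t : nat) (h : history t) : 0 <= pa1_pmf a h.
Proof.
elim: t h => //= t IH h.
by rewrite mulr_ge0 ?IH ?attach_prob_ge0.
Qed.

Lemma pa1_pmf_sum1 (t : nat) : \sum_(h : history t) pa1_pmf a h = 1.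
Proof.
elim: t => [|t IH]; first by rewrite (big_pred1 tt) //=; case.
transitivity (\sum_(h : history t) \sum_(c : option 'I_t)
    pa1_pmf a h * attach_prob a (pa1_graph h) c).
  by rewrite pair_bigA.
under eq_bigr do rewrite -mulr_sumr attach_prob_sum1 mulr1.
exact: IH.
Qed.

End Normalization.

(* Main.v *)
(* With a = delta / m = s, the law is that of PA^(1,s) merged in blocks of m.

   Low-degree vertices force modularity of order K^(-1/2): let L be a set of
   vertices of degree at most K and take B inside L such that the cut between B
   and its complement carries a quarter of vol L. Give independent uniform signs
   to the vertices outside B, and to each b in B the majority sign of its
   neighbours outside B (its own independent sign in case of a tie). By a
   fourth-moment bound an edge between B and its complement is correlated by at
   least c K^(-1/2) on average, all other edges have nonnegative correlation, and
   the signed volume has second moment at most (1 + K)^2 sum d_v^2. So if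
   sum d_v^2 is o(M^2), some choice of signs is a bipartition with modularity at
   least c K^(-1/2) vol L / M.

   For the attachment graph K = 8 m works, because every vertex sends out m edges
   and few of them are lost in the simplification. Both inputs come from the
   second moment Z_t of the degrees of PA_t^(1,s): E Z_(t+1) is at most
   (1 + 2 / ((2 + s) t)) E Z_t + 8 with 2 / (2 + s) < 2, hence E Z_t = o(t^2);
   consequently every degree is typically o(t), the conditional probability that
   the t-th edge is redundant, a union of O(m^2) attachment events, tends to 0 in
   mean, and by Cesaro o(n) edges are lost. *)

Require Import Defs.
From mathcomp Require Import all_boot all_order all_algebra.
From mathcomp Require Import reals zify ring lra.

Import Order.TTheory GRing.Theory Num.Theory.
Local Open Scope ring_scope.

(** * Random signs *)

(** Expectations over uniform signs are plain sums over all [e], without normalization, so a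
    constant bound [c] appears as a sum of [c] over [e]. Invariance of these sums under the
    bijection [flip S] does the work of independence. *)
Definition flip {V : finType} (S : {set V}) (e : {ffun V -> bool}) :
    {ffun V -> bool} := [ffun v => e v (+) (v \in S)].

Lemma flipK {V : finType} (S : {set V}) : involutive (flip S).
Proof. by move=> e; apply/ffunP => v; rewrite !ffunE addbK. Qed.

Lemma sum_flip {R : realType} {V : finType} (S : {set V})
    (f : {ffun V -> bool} -> R) : \sum_e f (flip S e) = \sum_e f e.
Proof. by rewrite [RHS](reindex_inj (inv_inj (flipK S))). Qed.

Lemma sum_flip_odd {R : realType} {V : finType} (S : {set V})
    (f : {ffun V -> bool} -> R) :
  (forall e, f (flip S e) = - f e) -> \sum_e f e = 0.
Proof.
move=> odd_f; have := sum_flip S f; under eq_bigr do rewrite odd_f.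
by rewrite sumrN; lra.
Qed.

Definition spin {R : realType} {V : finType} (e : {ffun V -> bool}) (v : V) : R :=
  (-1) ^+ e v.

Definition spin_sum {R : realType} {V : finType} (e : {ffun V -> bool})
  (S : {set V}) : R := \sum_(v in S) spin e v.

Lemma spin_flip {R : realType} {V : finType} (S : {set V}) e v :
  spin (flip S e) v = (if v \in S then - spin e v else spin e v) :> R.
Proof. by rewrite /spin ffunE; case: (v \in S); case: (e v) => /=; rewrite ?opprK. Qed.

Lemma sqr_spin {R : realType} {V : finType} (e : {ffun V -> bool}) v :
  spin e v ^+ 2 = 1 :> R.
Proof. by rewrite /spin; case: (e v); rewrite /= ?expr0 ?expr1 ?sqrrN expr1n. Qed.

Lemma spin_sum_flip_disjoint {R : realType} {V : finType} (S T : {set V}) e :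
  [disjoint S & T] -> spin_sum (flip T e) S = spin_sum e S :> R.
Proof.
move=> dST; apply: eq_bigr => v vS.
by rewrite spin_flip (disjointFr dST vS).
Qed.

Lemma spin_sum_flip_sub {R : realType} {V : finType} (S T : {set V}) e :
  S \subset T -> spin_sum (flip T e) S = - spin_sum e S :> R.
Proof.
move=> /subsetP sST; rewrite -sumrN; apply: eq_bigr => v /sST vT.
by rewrite spin_flip vT.
Qed.

Lemma spin_sum_setD {R : realType} {V : finType} (S T : {set V}) e :
  spin_sum e S = spin_sum e (S :&: T) + spin_sum e (S :\: T) :> R.
Proof.
rewrite /spin_sum (bigID (mem T)) /=; congr (_ + _); apply: eq_bigl => v.
  by rewrite inE.
by rewrite inE andbC.
Qed.

(** Induction on the size of [S], splitting off one vertex [a]: terms odd in [spin e a] vanish, and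
    with [k] vertices left the fourth moment is at most [1 + 6 k + 3 k^2 <= 3 (k + 1)^2]. *)
Lemma spin_sum_moments {R : realType} {V : finType} (S : {set V}) :
  \sum_e (spin_sum e S : R) ^+ 2 = \sum_(e : {ffun V -> bool}) #|S|%:R
  /\ \sum_e (spin_sum e S : R) ^+ 4 <= \sum_(e : {ffun V -> bool}) 3 * #|S|%:R ^+ 2.
Proof.
elim: {S}#|S| {-2}S (erefl #|S|) => [|k IH] S cardS.
  have S0 : S = set0 by apply/eqP; rewrite -cards_eq0 cardS.
  split; [apply: eq_bigr | apply: ler_sum] => e _.
    by rewrite cardS /spin_sum S0 big_set0 expr0n.
  by rewrite cardS /spin_sum S0 big_set0 !expr0n mulr0.
have [a aS] : exists a, a \in S by apply/set0Pn; rewrite -card_gt0 cardS.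
have cardD : #|S :\ a| = k by move: cardS; rewrite (cardsD1 a S) aS => -[].
have [IH2 IH4] := IH _ cardD; rewrite cardD in IH2 IH4.
have splitX e : spin_sum e S = spin e a + spin_sum e (S :\ a) :> R.
  by rewrite /spin_sum (big_setD1 a).
have odd_a (f : R -> R) : \sum_e spin e a * f (spin_sum e (S :\ a)) = 0 :> R.
  apply: (sum_flip_odd [set a]) => e; rewrite spin_flip inE eqxx.
  rewrite spin_sum_flip_disjoint ?mulNr //.
  by rewrite disjoint_sym disjoints1 !inE eqxx.
split.
  have -> : \sum_e spin_sum e S ^+ 2 =
      \sum_e (1 + 2 * (spin e a * spin_sum e (S :\ a)) + spin_sum e (S :\ a) ^+ 2) :> R.
    by apply: eq_bigr => e _; rewrite splitX sqrrD sqr_spin -mulr_natl.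
  rewrite !big_split /= -mulr_sumr (odd_a id) mulr0 addr0 IH2 -big_split /=.
  by apply: eq_bigr => e _; rewrite cardS -natr1 addrC.
have -> : \sum_e spin_sum e S ^+ 4 =
    \sum_e (1 + 6 * spin_sum e (S :\ a) ^+ 2 + spin_sum e (S :\ a) ^+ 4
      + spin e a * (4 * spin_sum e (S :\ a) + 4 * spin_sum e (S :\ a) ^+ 3)) :> R.
  apply: eq_bigr => e _; rewrite splitX.
  move: (sqr_spin e a : _ = 1 :> R); set x := spin e a; set y := spin_sum e _.
  move=> x2.
  have -> : (x + y) ^+ 4 = (x ^+ 2) ^+ 2 + 6 * x ^+ 2 * y ^+ 2 + y ^+ 4 +
     x * (4 * x ^+ 2 * y + 4 * y ^+ 3) by ring.
  by rewrite x2; ring.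
rewrite !big_split /= (odd_a (fun x => 4 * x + 4 * x ^+ 3)) addr0 -mulr_sumr IH2.
apply: le_trans (lerD (lexx _) IH4) _.
rewrite mulr_sumr -!big_split /=; apply: ler_sum => e _.
rewrite cardS -natr1.
have : 0 <= k%:R :> R by [].
by nra.
Qed.

(* The pointwise bound is [y >= y^2 (3 - y^2) / 2] at [y = |X| / tau]. *)
Lemma spin_sum_norm_ge {R : realType} {V : finType} (S : {set V}) (tau : R) :
  0 < tau -> 2 * #|S|%:R <= tau ^+ 2 ->
  \sum_(e : {ffun V -> bool}) (3 * #|S|%:R / (4 * tau)) <=
  \sum_e `|spin_sum e S : R|.
Proof.
move=> tau0 leS; have [E2 E4] := @spin_sum_moments R V S.
have pw e : 3 / (2 * tau) * spin_sum e S ^+ 2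
     - (2 * tau ^+ 3)^-1 * spin_sum e S ^+ 4 <= `|spin_sum e S : R|.
  have -> : spin_sum e S ^+ 4 = `|spin_sum e S : R| ^+ 4
    by rewrite -normrX ger0_norm // exprn_even_ge0.
  have -> : spin_sum e S ^+ 2 = `|spin_sum e S : R| ^+ 2 by rewrite real_normK // num_real.
  move: `|_| (normr_ge0 (spin_sum e S : R)) => x x0.
  rewrite -subr_ge0.
  have -> : x - (3 / (2 * tau) * x ^+ 2 - (2 * tau ^+ 3)^-1 * x ^+ 4) =
     (2 * tau ^+ 3)^-1 * (x * ((x - tau) ^+ 2 * (x + 2 * tau))).
    by field; rewrite gt_eqF.
  apply: mulr_ge0; first by rewrite invr_ge0 mulr_ge0 // exprn_ge0 // ltW.
  rewrite mulr_ge0 // mulr_ge0 ?sqr_ge0 //.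
  by rewrite addr_ge0 // mulr_ge0 // ltW.
apply: le_trans (ler_sum _ (fun e _ => pw e)).
rewrite sumrB -!mulr_sumr E2.
apply: le_trans (lerB (lexx _) (ler_wpM2l _ E4)); last first.
  by rewrite invr_ge0 mulr_ge0 // exprn_ge0 // ltW.
rewrite !mulr_sumr -sumrB; apply: ler_sum => e _.
move: leS (ler0n R #|S|); set k := #|S|%:R => leS k0.
(* The hypothesis [2 k <= tau^2] says that the fourth-moment term costs at most half of the
   second-moment term. *)
rewrite -subr_ge0.
have -> : 3 / (2 * tau) * k - (2 * tau ^+ 3)^-1 * (3 * k ^+ 2) - 3 * k / (4 * tau) =
   3 * k / (4 * tau ^+ 3) * (tau ^+ 2 - 2 * k) by field; rewrite gt_eqF.
apply: mulr_ge0; last by rewrite subr_ge0.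
by apply: divr_ge0; rewrite mulr_ge0 // exprn_ge0 // ltW.
Qed.

(** * Majority signs and their correlations *)

Lemma disjointU1s {V : finType} (v : V) (S T : {set V}) :
  [disjoint v |: S & T] = (v \notin T) && [disjoint S & T].
Proof. by rewrite -!setI_eq0 setIUl setU_eq0 !setI_eq0 disjoints1. Qed.

(** When [e] is a sign, so is the result, even in a tie; it is odd in [x] and [e] jointly. *)
Definition tie_break {R : realType} (x e : R) : R := if x == 0 then e else Num.sg x.

Lemma tie_breakN {R : realType} (x e : R) : tie_break (- x) (- e) = - tie_break x e.
Proof. by rewrite /tie_break oppr_eq0 sgrN; case: ifP. Qed.

Lemma sqr_tie_break {R : realType} (x e : R) : e ^+ 2 = 1 -> tie_break x e ^+ 2 = 1.
Proof. by rewrite /tie_break; case: eqP => // /eqP x0 _; rewrite sqr_sg x0. Qed.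

(* The average over the sign of the non-shared part [u] is an odd monotone
   function of the shared part [p]. *)
Lemma tie_break_shared {R : realType} (p u e : R) : e ^+ 2 = 1 ->
  (0 <= p -> 0 <= tie_break (p + u) e + tie_break (p - u) (- e)) /\
  (p <= 0 -> tie_break (p + u) e + tie_break (p - u) (- e) <= 0).
Proof.
move=> e2.
have bnd (x e' : R) : e' ^+ 2 = 1 -> -1 <= tie_break x e' <= 1.
  by move=> /(sqr_tie_break x) t2; nra.
have eN2 : (- e) ^+ 2 = 1 by rewrite sqrrN.
have pos (x e' : R) : 0 < x -> tie_break x e' = 1.
  by move=> x0; rewrite /tie_break gt_eqF // gtr0_sg.
have neg (x e' : R) : x < 0 -> tie_break x e' = -1.
  by move=> x0; rewrite /tie_break lt_eqF // ltr0_sg.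
have [b1 b2] := (bnd (p + u) e e2, bnd (p - u) (- e) eN2).
(* If [p] is not zero, one of [p + u] and [p - u] has the sign of [p], which fixes that term; the
   other has absolute value at most 1. If [p = 0], the two terms cancel. *)
case: (ltgtP p 0) => [p0|p0|->]; split => // _; last 2 first.
- by rewrite !add0r tie_breakN subrr.
- by rewrite !add0r tie_breakN subrr.
- case: (ltP u 0) => u0; [rewrite (neg (p + u)) | rewrite (neg (p - u))]; lra.
- case: (ltP u 0) => u0; [rewrite (pos (p - u)) | rewrite (pos (p + u))]; lra.
Qed.

Section Majority.
Context {R : realType} {V : finType}.
Implicit Types (S : V -> {set V}) (e : {ffun V -> bool}).

(** [S v] is the set of voters of [v]. A vertex without voters keeps its own sign, so one formula
    serves both sides of the cut. *)
Definition majority S e (v : V) : R := tie_break (spin_sum e (S v)) (spin e v).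

Lemma sqr_majority S e v : majority S e v ^+ 2 = 1.
Proof. by rewrite sqr_tie_break // sqr_spin. Qed.

Lemma majority_flip_sub S (T : {set V}) e v :
  v |: S v \subset T -> majority S (flip T e) v = - majority S e v.
Proof.
rewrite subUset sub1set => /andP[vT sT].
by rewrite /majority spin_sum_flip_sub // spin_flip vT tie_breakN.
Qed.

Lemma majority_flip_disjoint S (T : {set V}) e v :
  [disjoint v |: S v & T] -> majority S (flip T e) v = majority S e v.
Proof.
rewrite disjointU1s => /andP[vT sT].
by rewrite /majority spin_sum_flip_disjoint // spin_flip (negbTE vT).
Qed.

(** Flipping [u] and its voters reverses the majority at [u] and preserves the one at [v]. *)
Lemma majority_uncorrelated S u v : [disjoint u |: S u & v |: S v] ->
  \sum_e majority S e u * majority S e v = 0.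
Proof.
move=> duv; apply: (sum_flip_odd (u |: S u)) => e.
by rewrite majority_flip_sub // majority_flip_disjoint ?mulNr // disjoint_sym.
Qed.

(** Average over the flips of [U] and [W], each made of one vertex and its private voters. Since
    neither vertex votes for the other, each flip affects one factor only, and both averaged factors
    weakly have the sign of the shared vote [p]. *)
Lemma majority_correlation S u v : u != v -> u \notin S v -> v \notin S u ->
  0 <= \sum_e majority S e u * majority S e v.
Proof.
move=> uv uSv vSu.
pose U := u |: (S u :\: S v); pose W := v |: (S v :\: S u).
pose sym e := (majority S e u + majority S (flip U e) u)
            * (majority S e v + majority S (flip W e) v).
have Uv e : majority S (flip U e) v = majority S e v.
  apply: majority_flip_disjoint; rewrite disjoint_sym disjointU1s !inE negb_or uv uSv /=.
  rewrite -setI_eq0; apply/eqP/setP => w; rewrite !inE.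
  by case: eqP => [->|_]; rewrite ?(negbTE vSu) ?andbF //=; case: (w \in S v); rewrite ?andbF.
have Wu e : majority S (flip W e) u = majority S e u.
  apply: majority_flip_disjoint; rewrite disjoint_sym disjointU1s !inE negb_or eq_sym uv vSu /=.
  rewrite -setI_eq0; apply/eqP/setP => w; rewrite !inE.
  by case: eqP => [->|_]; rewrite ?(negbTE uSv) ?andbF //=; case: (w \in S u); rewrite ?andbF.
have flipUW e : majority S (flip U (flip W e)) u = majority S (flip U e) u.
  have -> : flip U (flip W e) = flip W (flip U e).
    by apply/ffunP => w; rewrite !ffunE -!addbA [(w \in W) (+) _]addbC.
  exact: Wu.
pose f e : R := majority S e u * majority S e v.
have sum_sym : \sum_e sym e = 4 * \sum_e f e.
  transitivity (\sum_e (f e + f (flip U e) + f (flip W e) + f (flip U (flip W e)))).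
    by apply: eq_bigr => e _; rewrite /sym /f !Uv !Wu flipUW; ring.
  rewrite !big_split /= (sum_flip U f) (sum_flip W f).
  by rewrite (sum_flip W (fun e => f (flip U e))) (sum_flip U f); ring.
suff : 0 <= \sum_e sym e by rewrite sum_sym /f; lra.
apply: sumr_ge0 => e _; rewrite /sym /majority.
pose p : R := spin_sum e (S u :&: S v).
(* The flip keeps the shared votes and negates the private votes and the own sign, as in
   [tie_break_shared]. *)
have shared x y : x \notin S y -> let T := x |: (S x :\: S y) in
    tie_break (spin_sum e (S x)) (spin e x)
      + tie_break (spin_sum (flip T e) (S x)) (spin (flip T e) x) =
    tie_break (spin_sum e (S x :&: S y) + spin_sum e (S x :\: S y)) (spin e x) +
    tie_break (spin_sum e (S x :&: S y) - spin_sum e (S x :\: S y)) (- spin e x) :> R.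
  move=> xSy T; rewrite (spin_sum_setD (S x) (S y) e).
  rewrite (spin_sum_setD (S x) (S y) (flip T e)) spin_flip !inE eqxx /=.
  rewrite (spin_sum_flip_sub (S x :\: S y)) ?subsetUr //.
  rewrite spin_sum_flip_disjoint // disjoint_sym disjointU1s !inE negb_and xSy orbT /=.
  by rewrite -setI_eq0; apply/eqP/setP => w; rewrite !inE; case: (w \in S y); rewrite ?andbF.
rewrite (shared u v uSv) (shared v u vSu) [S v :&: S u]setIC -/p.
have [u_ge u_le] := tie_break_shared p (spin_sum e (S u :\: S v)) _ (sqr_spin e u).
have [v_ge v_le] := tie_break_shared p (spin_sum e (S v :\: S u)) _ (sqr_spin e v).
have [p0|p0] := leP 0 p; first by rewrite mulr_ge0 ?u_ge ?v_ge.
by rewrite mulr_le0 ?u_le ?v_le // ltW.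
Qed.

End Majority.

(** * Modularity of a bipartition *)

Section SimpleGraph.
Context {V : finType} (G : simple_graph V).

(** There are no loops, so the map from ordered adjacent pairs to edges is two to one. *)
Lemma card_edges_in (S : {set V}) :
  (2 * #|edges_in G S| = \sum_(u in S) \sum_(v in S) G u v)%N.
Proof.
pose P := [set p : V * V | [&& G p.1 p.2, p.1 \in S & p.2 \in S]].
pose f (p : V * V) := [set p.1; p.2].
transitivity #|P|; last first.
  rewrite pair_big /= -sum1dep_card big_mkcond [RHS]big_mkcond /=.
  by apply: eq_bigr => -[u v] _ /=; case: (G u v); case: (u \in S); case: (v \in S).
rewrite -[#|P|]sum1_card (partition_big f (mem (edges_in G S))) /=; last first.
  move=> [u v]; rewrite !inE /= => /and3P[uv uS vS].
  rewrite subUset !sub1set uS vS !andbT.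
  by apply/imsetP; exists (u, v); rewrite ?inE.
rewrite mulnC -sum_nat_const; apply: eq_bigr => E.
rewrite inE => /andP[/imsetP[[u v]]]; rewrite inE /= => uv -> .
rewrite subUset !sub1set => /andP[uS vS].
have neq_uv : u != v by apply: contraTneq uv => ->; rewrite adj_irr.
transitivity #|[set (u, v); (v, u)]|.
  by rewrite cards2 xpair_eqE negb_and neq_uv.
rewrite -sum1_card; apply: eq_bigl => -[x y]; rewrite !inE !xpair_eqE /f /=.
apply/orP/andP => [[]/andP[/eqP-> /eqP->]|[/and3P[xy _ _] /eqP/setP eqE]].
- by rewrite uv uS vS.
- by rewrite adj_sym uv uS vS setUC.
have := eqE x; have := eqE y; rewrite !inE !eqxx orbT /=.
have neq_xy : x != y by apply: contraTneq xy => ->; rewrite adj_irr.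
move=> /esym/orP[]/eqP yE /esym/orP[]/eqP xE; rewrite xE yE ?eqxx in neq_xy * => //.
- by right.
- by left.
Qed.

Lemma deg_sum (v : V) : deg G v = (\sum_u G v u)%N.
Proof. by rewrite /deg -sum1dep_card big_mkcond; apply: eq_bigr => u _; case: (G v u). Qed.

Lemma card_edges : (2 * #|edges G| = vol G [set: V])%N.
Proof.
have -> : edges G = edges_in G [set: V] by apply/setP=> E; rewrite inE subsetT andbT.
rewrite card_edges_in; apply: eq_big => [v|v _]; first by rewrite inE.
by rewrite deg_sum; apply: eq_bigl => u; rewrite inE.
Qed.

(** Removing [set0] keeps this a partition when [A] is empty or everything. *)
Lemma bipartition_partition (A : {set V}) :
  partition ([set A; ~: A] :\ set0) [set: V].
Proof.
apply/and3P; split; last by rewrite !inE eqxx.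
- apply/eqP/setP => v; rewrite inE; apply/bigcupP.
  exists (if v \in A then A else ~: A); last by case: ifP => vA; rewrite ?inE vA.
  have vX : v \in (if v \in A then A else ~: A) by case: ifP => vA; rewrite ?inE vA.
  rewrite !inE; apply/andP; split; first by apply: contraTneq vX => ->; rewrite inE.
  by case: ifP; rewrite eqxx ?orbT.
- have AC : [disjoint A & ~: A] by rewrite -setI_eq0 setICr.
  apply/trivIsetP => X Y; rewrite !inE => /andP[_ /orP[]/eqP->] /andP[_ /orP[]/eqP->];
  by rewrite ?eqxx // disjoint_sym.
Qed.

End SimpleGraph.

(** The left-hand side is the modularity of the partition into [x = 1] and [x = -1]. With the
    indicators [(1 + x) / 2] and [(1 - x) / 2], linear terms cancel between the two parts, and
    constants cancel between edges and volumes. *)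
Lemma max_modularity_ge_bipartition {R : realType} {V : finType}
    (G : simple_graph V) (x : V -> R) (W := (vol G [set: V])%:R : R) :
  0 < W -> (forall v, x v ^+ 2 = 1) ->
  ((\sum_u \sum_v (G u v)%:R * (x u * x v)) / W
     - ((\sum_v (deg G v)%:R * x v) / W) ^+ 2) / 2 <= max_modularity R G.
Proof.
move=> W0 x2; pose A := [set v | x v == 1].
have xE v : x v = if v \in A then 1 else -1.
  move/eqP: (x2 v); rewrite sqrf_eq1 inE => /orP[]/eqP-> //; first by rewrite eqxx.
  by case: eqP.
apply: le_trans _ (max_modularity_ge R G (bipartition_partition A)).
pose f S : R := #|edges_in G S|%:R / #|edges G|%:R
                 - ((vol G S)%:R / (2 * #|edges G|%:R)) ^+ 2.
have W2 : 2 * #|edges G|%:R = W by rewrite /W -card_edges natrM.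
have f0 : f set0 = 0.
  have e0 : #|edges_in G set0| = 0%N.
    apply/eqP; have := card_edges_in G set0.
    by rewrite big_set0 => /eqP; rewrite muln_eq0.
  by rewrite /f e0 /vol big_set0 !mul0r expr0n subr0.
(* An empty part contributes [f set0 = 0], so the sum may run over both sets; they differ because
   [0 < W] makes [V] nonempty. *)
have -> : modularity R G ([set A; ~: A] :\ set0) = f A + f (~: A).
  have neqA : A \notin [set ~: A].
    rewrite inE; apply/eqP => /setP AC.
    have [v _|noV] := pickP (@predT V); last first.
      by move: W0; rewrite /W /vol big1 ?ltxx // => v; have := noV v.
    by have := AC v; rewrite [in RHS]inE; case: (v \in A).
  transitivity (\sum_(S in [set A; ~: A]) f S); last by rewrite big_setU1 //= big_set1.
  rewrite [RHS](bigID (pred1 set0)) /= [X in X + _]big1 ?add0r; last first.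
    by move=> S /andP[_ /eqP->].
  by apply: eq_bigl => S; rewrite !inE andbC.
have fE (S : {set V}) (i : V -> R) : (forall v, i v = (v \in S)%:R) ->
    f S = (\sum_u \sum_v (G u v)%:R * (i u * i v)) / W
          - ((\sum_v (deg G v)%:R * i v) / W) ^+ 2.
  move=> iE; rewrite /f W2; congr (_ - (_ / _) ^+ 2).
    have : 2 * #|edges_in G S|%:R = \sum_u \sum_v (G u v)%:R * (i u * i v) :> R.
      rewrite -natrM card_edges_in natr_sum big_mkcond; apply: eq_bigr => u _.
      rewrite natr_sum; case: ifP => uS; last first.
        by rewrite big1 // => v _; rewrite iE uS mul0r mulr0.
      rewrite big_mkcond; apply: eq_bigr => v _; rewrite !iE uS mul1r.
      by case: ifP; rewrite ?mulr1 ?mulr0.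
    move=> <-; rewrite -W2; field.
    by move: W0; rewrite -W2; rewrite pmulr_rgt0 // => /gt_eqF ->.
  rewrite natr_sum big_mkcond; apply: eq_bigr => v _.
  by rewrite iE; case: ifP; rewrite ?mulr1 ?mulr0.
rewrite (fE A (fun v => (1 + x v) / 2)); last first.
  by move=> v; rewrite xE; case: (v \in A) => /=; field.
rewrite (fE (~: A) (fun v => (1 - x v) / 2)); last first.
  by move=> v; rewrite xE in_setC; case: (v \in A) => /=; field.
have volE (y : R) : \sum_v (deg G v)%:R * ((1 + y * x v) / 2) =
    (W + y * \sum_v (deg G v)%:R * x v) / 2.
  transitivity (\sum_v ((deg G v)%:R + y * ((deg G v)%:R * x v)) / 2).
    by apply: eq_bigr => v _; ring.
  rewrite -mulr_suml big_split /= -mulr_sumr; congr ((_ + _) / _).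
  by rewrite /W natr_sum; apply: eq_bigl => v; rewrite inE.
have := volE 1; under eq_bigr do rewrite mul1r; rewrite mul1r => ->.
have := volE (-1); under eq_bigr do rewrite mulN1r; rewrite mulN1r => ->.
set D := \sum_v (deg G v)%:R * x v.
set Ga := \sum_u \sum_v (G u v)%:R * (x u * x v).
set e1 := \sum_u _; set e2 := \sum_u _.
have eE : e1 + e2 = (W + Ga) / 2.
  rewrite /e1 /e2 -big_split /W natr_sum /= [X in _ = (X + _) / 2](eq_bigl xpredT); last first.
    by move=> v; rewrite inE.
  rewrite /Ga -big_split /= mulr_suml; apply: eq_bigr => u _.
  rewrite -big_split deg_sum natr_sum -big_split mulr_suml; apply: eq_bigr => v _.
  by rewrite /=; field.
have -> : e2 = (W + Ga) / 2 - e1 by rewrite -eE; ring.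
rewrite le_eqVlt; apply/orP; left; apply/eqP; field.
by rewrite gt_eqF.
Qed.

(** * Low-degree vertices *)

(** First-moment method; [i0] excludes the empty type, where both sums are 0. *)
Lemma exists_le_of_sum {R : realType} {I : finType} (i0 : I) (f g : I -> R) :
  \sum_i f i <= \sum_i g i -> exists i, f i <= g i.
Proof.
move=> le_fg; apply/existsP; apply: contraTT le_fg => /existsPn lt_gf.
rewrite -ltNge; apply: ltr_sum; first by apply/hasP; exists i0; rewrite ?mem_index_enum.
by move=> i _; rewrite ltNge lt_gf.
Qed.

Section LowDegree.
Context {R : realType} {V : finType} (G : simple_graph V).

(** With [b \in B] built in, the set is empty for [b] outside [B]: sums may run over all [b], and
    vertices outside [B] have no voters. *)
Definition outside_nbrs (B : {set V}) (b : V) : {set V} :=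
  [set a | [&& b \in B, G b a & a \notin B]].

(** Put each vertex of [L] in [B] with probability 1/2. An ordered adjacent pair starting in [L]
    then goes from [B] to its complement with probability 1/4 if it ends in [L], and 1/2
    otherwise. *)
Lemma exists_cut (L : {set V}) : exists2 B : {set V}, B \subset L &
  (vol G L)%:R <= 4 * \sum_b #|outside_nbrs B b|%:R :> R.
Proof.
pose B (e : {ffun V -> bool}) := [set v in L | e v].
(* Each product is 4 if [e u] holds and [e v] fails, and 0 otherwise; its mean is 1 for distinct [u]
   and [v]. *)
pose f (e : {ffun V -> bool}) : R :=
  \sum_(u in L) \sum_v (G u v)%:R * ((1 - spin e u) * (1 + spin e v)).
have spin0 (v : V) : \sum_e spin e v = 0 :> R.
  by apply: (sum_flip_odd [set v]) => e; rewrite spin_flip inE eqxx.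
have spin2 (u v : V) : u != v -> \sum_e spin e u * spin e v = 0 :> R.
  move=> uv; apply: (sum_flip_odd [set u]) => e.
  by rewrite !spin_flip !inE eqxx eq_sym (negbTE uv) mulNr.
have [] := @exists_le_of_sum R _ [ffun=> true] (fun=> (vol G L)%:R) f.
  rewrite [leRHS]exchange_big /vol natr_sum [leLHS]exchange_big /=.
  apply: ler_sum => u _; rewrite deg_sum natr_sum [leLHS]exchange_big.
  rewrite [leRHS]exchange_big; apply: ler_sum => v _ /=; rewrite -mulr_sumr.
  have [Guv|_] := boolP (G u v); last by rewrite mul0r big1.
  have uv : u != v by apply: contraTneq Guv => ->; rewrite adj_irr.
  rewrite mul1r.
  have -> : \sum_e (1 - spin e u) * (1 + spin e v) =
     \sum_e (1 - spin e u + spin e v - spin e u * spin e v) :> R.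
    by apply: eq_bigr => e _; ring.
  by rewrite sumrB big_split sumrB /= !spin0 spin2 // addr0 !subr0.
move=> e le_f; exists (B e); first by apply/subsetP => v; rewrite inE => /andP[].
apply: le_trans le_f _; rewrite /f mulr_sumr big_mkcond; apply: ler_sum => u _.
case: ifP => uL; last by rewrite mulr_ge0.
rewrite -sum1dep_card natr_sum mulr_sumr [leRHS]big_mkcond; apply: ler_sum => v _.
rewrite !inE uL /= /spin.
case: (G u v); case: (e u); case: (v \in L); case: (e v);
  rewrite /= ?mul0r ?expr0 ?expr1; lra.
Qed.


Lemma tie_break_mulr (x e : R) : tie_break x e * x = `|x|.
Proof.
by rewrite /tie_break; case: eqP => [->|_]; rewrite ?mulr0 ?normr0 // -normrEsg.
Qed.

(** Voters keep their own signs, so the products of the sign of [b] with those of its voters add up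
    to the absolute value of the vote. Both orders of each pair occur, whence the factor 2. All
    other edges contribute a nonnegative amount by [majority_correlation]. *)
Lemma majority_gain (B : {set V}) (S := outside_nbrs B) :
  2 * \sum_e \sum_b `|spin_sum e (S b) : R| <=
  \sum_e \sum_u \sum_v (G u v)%:R * (majority S e u * majority S e v : R).
Proof.
pose r u v := [&& G u v, v \notin S u & u \notin S v].
have GE u v : (G u v)%:R = (v \in S u)%:R + (u \in S v)%:R + (r u v)%:R :> R.
  rewrite /r /S !inE [G v u]adj_sym.
  by case: (G u v); case: (u \in B); case: (v \in B); rewrite /= ?addr0 ?add0r.
have inS e : \sum_u \sum_v (v \in S u)%:R * (majority S e u * majority S e v)
    = \sum_u `|spin_sum e (S u)| :> R.
  apply: eq_bigr => u _; rewrite -(tie_break_mulr _ (spin e u)) -/(majority S e u).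
  rewrite /spin_sum mulr_sumr [RHS]big_mkcond; apply: eq_bigr => v _.
  case: ifP => vS; rewrite ?mul0r // mul1r; congr (_ * _).
  have Sv : S v = set0.
    apply/setP => w; rewrite !inE; move: vS; rewrite inE => /and3P[_ _].
    by move/negbTE->.
  by rewrite /majority Sv /spin_sum big_set0 /tie_break eqxx.
have -> : \sum_e \sum_u \sum_v (G u v)%:R * (majority S e u * majority S e v : R)
  = 2 * \sum_e \sum_b `|spin_sum e (S b)|
    + \sum_u \sum_v (r u v)%:R * \sum_e majority S e u * majority S e v.
  rewrite mulr_sumr.
  have -> : \sum_u \sum_v (r u v)%:R * \sum_e majority S e u * majority S e v =
      \sum_e \sum_u \sum_v (r u v)%:R * (majority S e u * majority S e v) :> R.
    rewrite [RHS]exchange_big; apply: eq_bigr => u _; rewrite [RHS]exchange_big.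
    by apply: eq_bigr => v _; rewrite mulr_sumr.
  rewrite -big_split; apply: eq_bigr => e _ /=.
  have inS' : \sum_u \sum_v (u \in S v)%:R * (majority S e u * majority S e v)
      = \sum_u `|spin_sum e (S u)| :> R.
    rewrite exchange_big -inS; apply: eq_bigr => u _; apply: eq_bigr => v _.
    by rewrite [X in _ * X]mulrC.
  rewrite mulr_natl mulr2n -{1}inS -inS' -!big_split; apply: eq_bigr => u _ /=.
  rewrite -!big_split; apply: eq_bigr => v _ /=; rewrite GE; ring.
rewrite lerDl; apply: sumr_ge0 => u _; apply: sumr_ge0 => v _.
have [/and3P[Guv vSu uSv]|_] := boolP (r u v); last by rewrite mul0r.
rewrite mul1r; apply: majority_correlation => //.
by apply: contraTneq Guv => ->; rewrite adj_irr.
Qed.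

(** Majorities at [u] and [v] are correlated only if [D u] and [D v] meet, so [meet u v] bounds the
    correlation. The second moment becomes a sum over [w] of the squared total degree of the [u]
    with [w] in [D u]: these are among [w] itself and its neighbours in [B], each of the latter of
    degree at most [K]. *)
Lemma majority_balance (K : nat) (B : {set V}) (S := outside_nbrs B) :
  (forall v, v \in B -> (deg G v <= K)%N) ->
  \sum_e (\sum_v (deg G v)%:R * majority S e v : R) ^+ 2 <=
  \sum_(e : {ffun V -> bool}) ((1 + K%:R) ^+ 2 * \sum_v (deg G v)%:R ^+ 2).
Proof.
move=> degB; pose D v := v |: S v.
pose meet u v : R := \sum_w (w \in D u)%:R * (w \in D v)%:R.
have corr u v : \sum_e majority S e u * majority S e v
    <= \sum_(e : {ffun V -> bool}) meet u v :> R.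
  have meet0 : 0 <= meet u v by apply: sumr_ge0 => w _; rewrite mulr_ge0.
  have [dis|] := boolP [disjoint D u & D v].
    by rewrite majority_uncorrelated // sumr_ge0.
  rewrite -setI_eq0 => /set0Pn[w]; rewrite inE => /andP[wu wv].
  apply: ler_sum => e _; apply: (@le_trans _ _ 1).
    have := sqr_majority (R := R) S e u; have := sqr_majority (R := R) S e v.
    by move: (majority S e u) (majority S e v) => x y; nra.
  rewrite /meet (bigD1 w) //= wu wv mulr1 lerDl.
  by apply: sumr_ge0 => z _; rewrite mulr_ge0.
apply: (@le_trans _ _ (\sum_(e : {ffun V -> bool})
   \sum_u \sum_v (deg G u)%:R * (deg G v)%:R * meet u v)).
  have -> : \sum_e (\sum_v (deg G v)%:R * majority S e v : R) ^+ 2 =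
      \sum_u \sum_v (deg G u)%:R * (deg G v)%:R
        * \sum_e majority S e u * majority S e v.
    under [RHS]eq_bigr do (under eq_bigr do rewrite mulr_sumr; rewrite exchange_big /=).
    rewrite [RHS]exchange_big; apply: eq_bigr => e _.
    rewrite expr2 big_distrlr; apply: eq_bigr => u _; apply: eq_bigr => v _ /=.
    by ring.
  rewrite [leRHS]exchange_big; apply: ler_sum => u _.
  rewrite [leRHS]exchange_big; apply: ler_sum => v _.
  by rewrite -mulr_sumr; apply: ler_wpM2l => //; rewrite mulr_ge0.
apply: ler_sum => e _.
have -> : \sum_u \sum_v (deg G u)%:R * (deg G v)%:R * meet u v =
    \sum_w (\sum_u (w \in D u)%:R * (deg G u)%:R) ^+ 2 :> R.
  under [LHS]eq_bigr do (under eq_bigr do rewrite /meet mulr_sumr; rewrite exchange_big /=).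
  rewrite [LHS]exchange_big; apply: eq_bigr => w _.
  rewrite expr2 big_distrlr; apply: eq_bigr => u _; apply: eq_bigr => v _ /=.
  by ring.
rewrite mulr_sumr; apply: ler_sum => w _; rewrite -exprMn.
apply: lerXn2r; rewrite ?nnegrE ?mulr_ge0 ?addr_ge0 //.
  by apply: sumr_ge0 => u _; rewrite mulr_ge0.
rewrite mulrDl mul1r.
apply: (@le_trans _ _ (\sum_u ((u == w)%:R * (deg G u)%:R + K%:R * (G w u)%:R))).
  apply: ler_sum => u _; rewrite !inE eq_sym [G u w]adj_sym.
  case: eqP => [->|_] /=; first by rewrite mul1r lerDl mulr_ge0.
  rewrite mul0r add0r; case: (boolP (u \in B)) => uB /=; last by rewrite mul0r mulr_ge0.
  case: (G w u); last by rewrite mul0r mulr0.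
  case: (w \notin B); last by rewrite mul0r mulr_ge0.
  by rewrite mul1r mulr1 ler_nat degB.
rewrite big_split -mulr_sumr -natr_sum -deg_sum lerD2r /=.
rewrite (bigD1 w) //= eqxx mul1r big1 ?addr0 // => u /negbTE->.
by rewrite mul0r.
Qed.

(** Some sign vector reaches the average. Votes have size at most [K] since [B] lies in [L], so
    [spin_sum_norm_ge] yields [3 |S b| / (4 tau)] for each [b], and by [exists_cut] the [|S b|] add
    up to at least a quarter of [vol G L]. *)
Lemma max_modularity_ge_low_degree (L : {set V}) (K : nat) (tau : R)
    (W := (vol G [set: V])%:R : R) :
  (forall v, v \in L -> (deg G v <= K)%N) ->
  0 < W -> 0 < tau -> 2 * K%:R <= tau ^+ 2 ->
  (3 * (vol G L)%:R / (8 * tau * W)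
    - (1 + K%:R) ^+ 2 * (\sum_v (deg G v)%:R ^+ 2) / W ^+ 2) / 2
  <= max_modularity R G.
Proof.
move=> degL W0 tau0 leK.
have [B BL cutB] := exists_cut L; set S := outside_nbrs B in cutB.
have degB v : v \in B -> (deg G v <= K)%N by move/(subsetP BL)/degL.
pose Q e : R := \sum_u \sum_v (G u v)%:R * (majority S e u * majority S e v).
pose D e : R := \sum_v (deg G v)%:R * majority S e v.
have [] := @exists_le_of_sum R _ [ffun=> true]
  (fun=> 3 * (vol G L)%:R / (8 * tau * W)
    - (1 + K%:R) ^+ 2 * (\sum_v (deg G v)%:R ^+ 2) / W ^+ 2)
  (fun e => Q e / W - (D e / W) ^+ 2).
  rewrite !sumrB; apply: lerB; last first.
    rewrite -mulr_suml; under eq_bigr do rewrite expr_div_n; rewrite -mulr_suml.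
    by rewrite ler_pM2r ?invr_gt0 ?exprn_gt0 // majority_balance.
  rewrite -[leRHS]mulr_suml; apply: le_trans _ (ler_wpM2r _ (majority_gain B)); last first.
    by rewrite invr_ge0 ltW.
  rewrite exchange_big [leRHS]mulrAC.
  apply: (@le_trans _ _ (2 / W * \sum_b \sum_(e : {ffun V -> bool})
      (3 * #|S b|%:R / (4 * tau)))).
    rewrite exchange_big mulr_sumr; apply: ler_sum => e _.
    rewrite -mulr_suml -mulr_sumr.
    have -> : 2 / W * (3 * (\sum_b #|S b|%:R) / (4 * tau)) =
        3 * (4 * \sum_b #|S b|%:R) / (8 * tau * W) :> R.
      by field; rewrite !gt_eqF.
    by rewrite ler_pM2r ?invr_gt0 ?mulr_gt0 // ler_pM2l.
  apply: ler_wpM2l; first by rewrite divr_ge0 // ltW.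
  apply: ler_sum => b _; apply: spin_sum_norm_ge => //.
  apply: le_trans leK; rewrite ler_pM2l // ler_nat.
  have [/degB|bB] := boolP (b \in B); last first.
    by rewrite (_ : S b = set0) ?cards0 //; apply/setP => v; rewrite !inE (negbTE bB).
  apply: leq_trans; apply: subset_leq_card; apply/subsetP => v.
  by rewrite !inE => /and3P[].
move=> e le_e; apply: le_trans _ (max_modularity_ge_bipartition _ _ W0 (sqr_majority S e)).
by rewrite ler_pM2r // invr_gt0.
Qed.

End LowDegree.

(** * Simplification of a multigraph *)

(** Stated over an [eqType] to serve both vertices and block numbers in [nat]. Ordered pairs are
    faithful to edges as long as no pair occurs in both directions. *)
Definition num_arcs {T : eqType} (s : seq (T * T)) : nat :=
  size (undup [seq p <- s | p.1 != p.2]).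

Lemma num_arcs_map {T U : eqType} (f : T -> U) (s : seq (T * T)) :
  injective f -> num_arcs [seq (f p.1, f p.2) | p <- s] = num_arcs s.
Proof.
move=> inj_f; rewrite /num_arcs filter_map undup_map_inj ?size_map; last first.
  by move=> [a b] [c d] /= [/inj_f-> /inj_f->].
by congr (size (undup _)); apply: eq_filter => p /=; rewrite (inj_eq inj_f).
Qed.

Lemma num_arcs_cons {T : eqType} (p : T * T) (s : seq (T * T)) :
  num_arcs (p :: s) = (num_arcs s + ~~ ((p.1 == p.2) || (p \in s)))%N.
Proof.
rewrite /num_arcs /=; case: ifP => [/negbTE neq|/negbFE->]; last by rewrite addn0.
rewrite /= mem_filter neq /=; case: (p \in s); first by rewrite addn0.
by rewrite addn1.
Qed.

Lemma num_arcs_size {T : eqType} (s : seq (T * T)) : (num_arcs s <= size s)%N.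
Proof. exact: leq_trans (size_undup _) (size_subseq (filter_subseq _ _)). Qed.

Section Simplify.
Context {V : finType} (M : multigraph V).

Lemma deg_simplify (v : V) : (deg (simplify M) v <= mdeg M v)%N.
Proof.
rewrite /deg /mdeg -!size_filter -(size_map snd) -(size_map fst [seq _ <- _ | _]) -size_cat.
set s := _ ++ _; apply: leq_trans (card_size s); apply: subset_leq_card.
apply/subsetP => u; rewrite inE /= /simplify_rel /= mem_cat => /andP[_ /orP[]] uv.
  by apply/orP; left; apply/mapP; exists (v, u); rewrite // mem_filter eqxx.
by apply/orP; right; apply/mapP; exists (u, v); rewrite // mem_filter eqxx.
Qed.

Lemma vol_simplify : (vol (simplify M) [set: V] <= 2 * size M)%N.
Proof.
rewrite -sum_mdeg /vol (eq_bigl xpredT); last by move=> v; rewrite inE.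
by apply: leq_sum => v _; apply: deg_simplify.
Qed.

Lemma card_arcs (P : pred (V * V)) :
  size [seq p <- undup [seq p <- M | p.1 != p.2] | P p] =
  #|[set p | [&& p \in (M : seq _), p.1 != p.2 & P p]]|.
Proof.
set s := [seq p <- _ | P p].
have us : uniq s by rewrite filter_uniq // undup_uniq.
rewrite -(card_uniqP us); apply: eq_card => p.
rewrite inE mem_filter mem_undup mem_filter.
by case: (P p); case: (p.1 != p.2); rewrite ?andbT ?andbF.
Qed.

Lemma vol_adj (G : simple_graph V) (L : {set V}) :
  vol G L = #|[set p : V * V | (p.1 \in L) && G p.1 p.2]|.
Proof.
rewrite /vol -sum1dep_card; under eq_bigr do rewrite /deg -sum1dep_card.
by rewrite pair_big_dep.
Qed.

(** Distinct arcs starting in [L] are ordered adjacent pairs counted by the volume; every other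
    vertex emits at most [m] arcs. *)
Lemma num_arcs_vol (m : nat) (L : {set V}) :
  (forall v, count (fun e : V * V => e.1 == v) M <= m)%N ->
  (num_arcs M <= vol (simplify M) L + m * #|~: L|)%N.
Proof.
move=> outM; rewrite /num_arcs; set s := undup _.
rewrite -(count_predC (fun p : V * V => p.1 \in L) s) -!size_filter; apply: leq_add.
  rewrite card_arcs vol_adj; apply: subset_leq_card; apply/subsetP => -[u v].
  by rewrite !inE /= /simplify_rel /= => /and3P[-> -> ->].
have les : (count (predC (fun p : V * V => p.1 \in L)) s
    <= count (predC (fun p : V * V => p.1 \in L)) M)%N.
  rewrite /s; apply: leq_trans (leq_count_subseq _ (undup_subseq _)) _.
  exact: leq_count_subseq (filter_subseq _ _).
rewrite size_filter; apply: leq_trans les _.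
rewrite mulnC -sum_nat_const.
apply: (@leq_trans (\sum_(v in ~: L) count (fun e : V * V => e.1 == v) M)).
  elim: (M : seq _) => [|e s' IH] /=; first by rewrite big1.
  rewrite big_split /=; apply: leq_add IH.
  have [eL //|eL] := boolP (e.1 \in L).
  by rewrite (bigD1 e.1) ?inE //= eqxx.
by apply: leq_sum => v _.
Qed.

(** Arcs never increase the injective rank [r], so an arc between distinct vertices never occurs
    with its reverse, and each gives two ordered adjacent pairs. *)
Lemma num_arcs_volT (r : V -> nat) :
  (forall e : V * V, e \in (M : seq _) -> r e.2 <= r e.1)%N -> injective r ->
  (2 * num_arcs M <= vol (simplify M) [set: V])%N.
Proof.
move=> desc inj_r.
have := card_arcs predT; rewrite filter_predT /num_arcs => ->.
set A := [set p | _]; pose rev (p : V * V) := (p.2, p.1).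
have inj_rev : injective rev by move=> [a b] [c d] [-> ->].
rewrite mul2n -addnn -{2}(card_imset A inj_rev).
have dis : [disjoint A & rev @: A].
  rewrite -setI_eq0; apply/eqP/setP => p; rewrite in_setI in_set0; apply/negP.
  move=> /andP[]; rewrite inE => /and3P[pM neq _] /imsetP[q].
  rewrite inE => /and3P[qM _ _] pE; move: (desc _ pM) (desc _ qM); rewrite pE /= => le1 le2.
  move: neq; rewrite pE /=; case/negP; apply/eqP; apply: inj_r.
  by apply/eqP; rewrite eqn_leq le1 le2.
have := (leq_card_setU A (rev @: A)).2; rewrite dis => /eqP <-.
rewrite vol_adj; apply: subset_leq_card; apply/subsetP => p; rewrite in_setU.
case/orP => [pA|/imsetP[q pA ->]]; move: pA; rewrite [_ \in A]inE => /and3P[pM neq _].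
  by rewrite !inE /= /simplify_rel /= neq -surjective_pairing pM.
by rewrite !inE /= /simplify_rel /= eq_sym neq -surjective_pairing pM orbT.
Qed.

End Simplify.

(** * The attachment graph *)

Lemma card_block (m t b : nat) : (0 < m)%N ->
  (#|[set i : 'I_t | i %/ m == b]| <= m)%N.
Proof.
move=> m0; rewrite -[leqRHS]card_ord.
pose f (i : 'I_t) : 'I_m := Ordinal (ltn_pmod i m0).
rewrite -(card_in_imset (f := f)) ?max_card // => i j.
rewrite !inE => /eqP bi /eqP bj [eq_mod]; apply: val_inj.
by rewrite /= (divn_eq i m) (divn_eq j m) bi bj eq_mod.
Qed.

Section ArcList.
Context {t : nat}.
Implicit Type h : history t.

(** With plain numbers as vertices, adding a vertex is a cons and [lift ord_max] disappears. *)
Definition arc_list h : seq (nat * nat) :=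
  [seq (val e.1, val e.2) | e <- pa1_graph h].

(** The merged graph in terms of block numbers makes sense for every [t], not only for multiples of
    [m], which permits induction one edge at a time. *)
Definition block_arcs (m : nat) h : seq (nat * nat) :=
  [seq (p.1 %/ m, p.2 %/ m)%N | p <- arc_list h].

Definition target (c : option 'I_t) : nat := if c is Some i then val i else t.

End ArcList.

Lemma arc_list_step (t : nat) (h : history t) (c : option 'I_t) :
  @arc_list t.+1 (h, c) = (t, target c) :: arc_list h.
Proof.
rewrite /arc_list /= -map_comp; congr ((_, _) :: _).
  by case: c => // i; exact: lift_max.
by apply: eq_map => e; congr (_, _); exact: lift_max.
Qed.

Lemma arc_list_fst (t : nat) (h : history t) :
  [seq p.1 | p <- arc_list h] = rev (iota 0 t).
Proof.
elim: t h => // t IH [h c]; rewrite arc_list_step [LHS]/= IH.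
by rewrite -addn1 iotaD rev_cat.
Qed.

Lemma arc_list_desc (t : nat) (h : history t) p :
  p \in arc_list h -> (p.2 <= p.1)%N.
Proof.
elim: t h => // t IH [h c]; rewrite arc_list_step inE => /orP[/eqP->|/IH//].
by case: c => //= i; exact: ltnW.
Qed.

(** The sources of the arcs are [t - 1, ..., 0], each once, and a block has at most [m] elements. *)
Lemma count_block_fst (m t b : nat) (h : history t) : (0 < m)%N ->
  (count (fun p => p.1 == b) (block_arcs m h) <= m)%N.
Proof.
move=> m0; rewrite count_map.
rewrite (eq_count (a2 := preim fst (fun k => k %/ m == b)%N)) //.
rewrite -count_map arc_list_fst count_rev -val_enum_ord count_map.
apply: leq_trans (card_block m t b m0).
rewrite -size_filter cardE; apply: uniq_leq_size => [|i].
  by rewrite filter_uniq // enum_uniq.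
by rewrite mem_filter !mem_enum [in X in _ -> X]inE => /andP[].
Qed.

Lemma block_arcs_pa_graph (m n : nat) (h : history (m * n)) :
  [seq (val e.1, val e.2) | e <- pa_graph h] = block_arcs m h.
Proof. by rewrite /block_arcs /arc_list /pa_graph /map_vertices -!map_comp. Qed.

Lemma num_arcs_pa_graph (m n : nat) (h : history (m * n)) :
  num_arcs (pa_graph h) = num_arcs (block_arcs m h).
Proof. by rewrite -block_arcs_pa_graph (num_arcs_map _ _ val_inj). Qed.

Lemma pa_graph_outdeg (m n : nat) (h : history (m * n)) (v : 'I_n) : (0 < m)%N ->
  (count (fun e : 'I_n * 'I_n => e.1 == v) (pa_graph h) <= m)%N.
Proof.
move=> m0; apply: leq_trans (count_block_fst m _ v h m0).
by rewrite -block_arcs_pa_graph [in leqRHS]count_map; apply: eq_leq; apply: eq_count.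
Qed.

Lemma pa_graph_desc (m n : nat) (h : history (m * n)) (e : 'I_n * 'I_n) :
  e \in (pa_graph h : seq _) -> (e.2 <= e.1)%N.
Proof.
move=> eM; have : (val e.1, val e.2) \in block_arcs m h.
  by rewrite -block_arcs_pa_graph; apply/mapP; exists e.
by move=> /mapP[p /arc_list_desc le [-> ->]]; exact: leq_div2r.
Qed.

Lemma mdeg_map_vertices (V W : finType) (f : V -> W) (G : multigraph V) (w : W) :
  mdeg (map_vertices f G) w = (\sum_(v | f v == w) mdeg G v)%N.
Proof.
have sum_count (g : V * V -> V) :
    count (fun e => f (g e) == w) G = (\sum_(v | f v == w) count (fun e => g e == v) G)%N.
  elim: (G : seq _) => [|e s IH] /=; first by rewrite big1.
  rewrite big_split /= IH; congr (_ + _)%N.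
  have [fw|fw] := boolP (f (g e) == w).
    by rewrite (bigD1 (g e)) //= eqxx big1 // => v /andP[_]; rewrite eq_sym => /negbTE->.
  by rewrite big1 // => v fv; case: eqP => // ev; rewrite ev fv in fw.
by rewrite /mdeg big_split /= -!sum_count !count_map.
Qed.

(** * Second moment of the degrees *)

Section SecondMoment.
Context {R : realType}.

Definition sum_sq_deg {t : nat} (h : history t) : R :=
  \sum_i (mdeg (pa1_graph h) i)%:R ^+ 2.

(** Cauchy-Schwarz, from [2 x y <= x^2 + y^2]. *)
Lemma sqr_sum_le (I : finType) (P : {set I}) (x : I -> R) :
  (\sum_(i in P) x i) ^+ 2 <= #|P|%:R * \sum_(i in P) x i ^+ 2.
Proof.
have le2 : 2 * (\sum_(i in P) x i) ^+ 2
    <= \sum_(i in P) \sum_(j in P) (x i ^+ 2 + x j ^+ 2).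
  rewrite expr2 big_distrlr mulr_sumr; apply: ler_sum => i _ /=.
  rewrite mulr_sumr; apply: ler_sum => j _.
  by have := sqr_ge0 (x i - x j); nra.
have E : \sum_(i in P) \sum_(j in P) (x i ^+ 2 + x j ^+ 2) =
    2 * (#|P|%:R * \sum_(i in P) x i ^+ 2).
  under eq_bigr do rewrite big_split /= sumr_const.
  by rewrite big_split /= sumr_const sumrMnl -[_ *+ _]mulr_natl; ring.
by move: le2; rewrite E ler_pM2l.
Qed.

(** Simplification only lowers degrees, and a merged degree is a sum over at most [m] vertices, so
    Cauchy-Schwarz costs a factor [m]. *)
Lemma sum_sq_deg_simplify (m n : nat) (h : history (m * n)) : (0 < m)%N ->
  \sum_v (deg (simplify (pa_graph h)) v)%:R ^+ 2 <= m%:R * sum_sq_deg h.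
Proof.
move=> m0; rewrite /sum_sq_deg.
rewrite (partition_big (@Defs.merge m n) xpredT) //= mulr_sumr; apply: ler_sum => v _.
apply: (@le_trans _ _ ((\sum_(i in [set i | @Defs.merge m n i == v])
    (mdeg (pa1_graph h) i)%:R) ^+ 2)).
  rewrite ler_sqr ?nnegrE ?sumr_ge0 // -natr_sum ler_nat.
  apply: leq_trans (deg_simplify _ _) _; rewrite mdeg_map_vertices.
  by apply: eq_leq; apply: eq_bigl => i; rewrite inE.
apply: le_trans (sqr_sum_le _ _ _) _.
rewrite [X in _ * X](eq_bigl (fun i => Defs.merge i == v)); last by move=> i; rewrite inE.
rewrite ler_wpM2r ?sumr_ge0 // => [i _|]; first exact: sqr_ge0.
by rewrite ler_nat; apply: card_block.
Qed.

End SecondMoment.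

(** Arcs that become loops or repetitions after merging. The truncated subtraction is exact, as
    there are [t] arcs in all. *)
Definition lost (m : nat) {t : nat} (h : history t) : nat := t - num_arcs (block_arcs m h).

(** * Consequences of few lost edges and a small second moment *)

Section Deterministic.
Context {R : realType} (m n : nat) (m0 : (0 < m)%N) (n0 : (0 < n)%N).
Context (h : history (m * n)).

Let G := simplify (pa_graph h).

Lemma num_arcs_le : (num_arcs (pa_graph h) <= m * n)%N.
Proof. by rewrite -(size_pa_graph h) num_arcs_size. Qed.

Lemma vol_pa_le : (vol G [set: 'I_n] <= 2 * (m * n))%N.
Proof. by rewrite -(size_pa_graph h) vol_simplify. Qed.

Lemma vol_pa_ge : (2 * (m * n) <= vol G [set: 'I_n] + 2 * lost m h)%N.
Proof.
have := num_arcs_volT (pa_graph h) val (@pa_graph_desc m n h) val_inj.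
have := num_arcs_le; rewrite /lost -num_arcs_pa_graph -/G; lia.
Qed.

Lemma avg_degree_pa (eps : R) : (lost m h)%:R <= (m * n)%:R * eps ->
  `|avg_degree R G - 2 * m%:R| <= 2 * m%:R * eps.
Proof.
move=> le_lost; have n0' : 0 < n%:R :> R by rewrite ltr0n.
have -> : avg_degree R G = (vol G [set: 'I_n])%:R / n%:R.
  by rewrite /avg_degree card_ord /vol; congr (_%:R / _); apply: eq_bigl => v; rewrite inE.
have := vol_pa_le; have := vol_pa_ge; rewrite -!(ler_nat R) natrD !natrM.
move: le_lost; rewrite natrM; set W := (vol G _)%:R; set l := (lost _ _)%:R => le_lost ge le.
rewrite distrC ger0_norm; last first.
  by rewrite subr_ge0 ler_pdivrMr //; lra.
rewrite lerBlDr -lerBlDl ler_pdivlMr //; nra.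
Qed.

(** At most [n / 4] vertices have degree above [8 m], and they emit at most a quarter of the [m n]
    arcs; at most another quarter is lost, so at least [m n / 2] distinct arcs start in [L]. With
    [K = 8 m] and [tau = 4 sqrt m] the main term is at least [3 c / sqrt m], the error is at most
    [c / sqrt m], and half of the difference is [c / sqrt m]. *)
Lemma max_modularity_pa (c := 128^-1 : R) :
  (4 * lost m h <= m * n)%N ->
  sum_sq_deg h <= (81 * 128 * m%:R ^+ 4)^-1 * (m * n)%:R ^+ 2 :> R ->
  c / Num.sqrt m%:R <= max_modularity R G.
Proof.
move=> le_lost le_Z.
have N0 : (0 < m * n)%N by rewrite muln_gt0 m0.
pose L := [set v | (deg G v <= 8 * m)%N].
have cardL : (4 * #|~: L| <= n)%N.
  have : (#|~: L| * (8 * m) <= vol G [set: 'I_n])%N.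
    rewrite -sum_nat_const /vol [leqRHS](eq_bigl xpredT); last by move=> v; rewrite inE.
    rewrite [leqRHS](bigID (mem (~: L))) /=; apply: leq_trans (leq_addr _ _).
    by apply: leq_sum => v; rewrite !inE -ltnNge => /ltnW.
  have := vol_pa_le; nia.
have volL : (m * n <= 2 * vol G L)%N.
  have := num_arcs_vol _ m L (fun v => pa_graph_outdeg m n h v m0).
  rewrite -/G => leU; move: le_lost; rewrite /lost -num_arcs_pa_graph; nia.
have volT := vol_pa_le.
have volT' : (m * n <= vol G [set: 'I_n])%N by have := vol_pa_ge; lia.
have m0' : 0 < m%:R :> R by rewrite ltr0n.
have s0 : 0 < Num.sqrt m%:R :> R by rewrite sqrtr_gt0.
have s2 : Num.sqrt m%:R ^+ 2 = m%:R :> R by rewrite sqr_sqrtr // ltW.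
have s1 : 1 <= Num.sqrt m%:R :> R by rewrite -{1}sqrtr1 ler_wsqrtr // ler1n.
set W := (vol G [set: 'I_n])%:R : R.
have W0 : 0 < W by rewrite ltr0n; lia.
have tau0 : 0 < 4 * Num.sqrt m%:R :> R by rewrite mulr_gt0.
have leK : 2 * (8 * m)%:R <= (4 * Num.sqrt m%:R) ^+ 2 :> R.
  by rewrite exprMn s2 natrM; lra.
have degL v : v \in L -> (deg G v <= 8 * m)%N by rewrite inE.
apply: le_trans _ (max_modularity_ge_low_degree G L _ _ degL W0 tau0 leK); rewrite -/W.
have first : 3 * c / Num.sqrt m%:R <= 3 * (vol G L)%:R / (8 * (4 * Num.sqrt m%:R) * W).
  have -> : 3 * c / Num.sqrt m%:R = 3 * W / 4 / (8 * (4 * Num.sqrt m%:R) * W).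
    by rewrite /c; field; rewrite !gt_eqF.
  rewrite ler_pM2r ?invr_gt0 ?mulr_gt0 // -mulrA ler_pM2l // ler_pdivrMr //.
  by rewrite -natrM ler_nat; lia.
have second : (1 + (8 * m)%:R) ^+ 2 * (\sum_v (deg G v)%:R ^+ 2) / W ^+ 2 <= c / Num.sqrt m%:R.
  rewrite ler_pdivrMr ?exprn_gt0 //.
  (* The bound [1 + 8 m <= 9 m] is the source of the factor 81 in the hypothesis. *)
  apply: (@le_trans _ _ ((9 * m%:R) ^+ 2 * (m%:R * ((81 * 128 * m%:R ^+ 4)^-1 * W ^+ 2)))).
    apply: ler_pM; rewrite ?sqr_ge0 ?sumr_ge0 //.
    - by move=> v _; exact: sqr_ge0.
    - rewrite ler_sqr ?nnegrE ?addr_ge0 ?mulr_ge0 // natrM.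
      have : 1 <= m%:R :> R by rewrite ler1n.
      lra.
    apply: le_trans (sum_sq_deg_simplify m n h m0) _.
    rewrite ler_pM2l //; apply: le_trans le_Z _.
    rewrite ler_pM2l ?invr_gt0 ?mulr_gt0 ?exprn_gt0 //.
    by rewrite ler_sqr ?nnegrE // ler_nat.
  have -> : (9 * m%:R) ^+ 2 * (m%:R * ((81 * 128 * m%:R ^+ 4)^-1 * W ^+ 2)) =
      c / m%:R * W ^+ 2 by rewrite /c; field; rewrite gt_eqF.
  rewrite ler_pM2r ?exprn_gt0 // ler_pM2l ?invr_gt0 // lef_pV2 ?posrE //.
  by rewrite -{2}s2 expr2 ler_peMl // ltW.
rewrite ler_pdivlMr //; move: first second; rewrite -mulrA; set q := c / _.
by move=> ? ?; lra.
Qed.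

End Deterministic.

(** * Expected second moment and expected loss *)

Lemma big_option_ord {R : realType} (t : nat) (F : option 'I_t -> R) :
  \sum_c F c = F None + \sum_i F (Some i).
Proof.
rewrite (bigD1 None) //= (reindex_omap Some id) /=; last by case.
by congr (_ + _); apply: eq_bigl => i; rewrite eqxx.
Qed.

Section Expectation.
Context {R : realType} (a : R) (a_gt : -1 < a).

Definition expect {t : nat} (f : history t -> R) : R :=
  \sum_(h : history t) pa1_pmf a h * f h.

Lemma expect_step (t : nat) (f : history t.+1 -> R) :
  expect f = expect (fun h : history t =>
    \sum_c attach_prob a (pa1_graph h) c * f (h, c)).
Proof.
transitivity (\sum_(h : history t) \sum_(c : option 'I_t)
    pa1_pmf a h * attach_prob a (pa1_graph h) c * f (h, c)).
  by rewrite pair_bigA; apply: eq_bigr => -[h c].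
by apply: eq_bigr => h _; rewrite mulr_sumr; apply: eq_bigr => c _; rewrite mulrA.
Qed.

Lemma ler_expect (t : nat) (f g : history t -> R) :
  (forall h, f h <= g h) -> expect f <= expect g.
Proof. by move=> fg; apply: ler_sum => h _; rewrite ler_wpM2l ?pa1_pmf_ge0. Qed.

Lemma expect_affine (t : nat) (c d : R) (f : history t -> R) :
  expect (fun h => c * f h + d) = c * expect f + d.
Proof.
rewrite /expect -[X in _ = _ + X]mul1r -(pa1_pmf_sum1 a_gt t) mulr_suml mulr_sumr -big_split.
by apply: eq_bigr => h _ /=; ring.
Qed.

Lemma expectD (t : nat) (f g : history t -> R) :
  expect (fun h => f h + g h) = expect f + expect g.
Proof. by rewrite -big_split; apply: eq_bigr => h _; rewrite mulrDr. Qed.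

Lemma expect_ge0 (t : nat) (f : history t -> R) :
  (forall h, 0 <= f h) -> 0 <= expect f.
Proof. by move=> f0; apply: sumr_ge0 => h _; rewrite mulr_ge0 ?pa1_pmf_ge0. Qed.

(** The 4 is the squared degree of a new vertex with a loop; otherwise the new vertex adds 1 and the
    chosen one, of degree [D], adds [2 D + 1]. *)
Lemma sum_sq_deg_step (t : nat) (h : history t) (c : option 'I_t) :
  @sum_sq_deg R t.+1 (h, c) <= sum_sq_deg h + 4
    + (if c is Some i then 2 * (mdeg (pa1_graph h) i)%:R else 0).
Proof.
rewrite /sum_sq_deg (bigD1_ord ord_max) //=.
under eq_bigr do rewrite mdeg_add_vertex_old.
rewrite mdeg_add_vertex_new; case: c => [i|]; last first.
  by under eq_bigr do rewrite [(_ + _)%N]addn0; move: (\sum_(_ < _) _) => x; lra.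
rewrite (bigD1 i) //= [in leRHS](bigD1 i) //= eqxx.
under eq_bigr => j ji do rewrite eq_sym (inj_eq Some_inj) (negbTE ji) [(_ + _)%N]addn0.
rewrite natrD; set y := \sum_(_ < _ | _) _; set x := (mdeg _ _)%:R.
by rewrite -[true%:R]/(1 : R); lra.
Qed.

(** Vertex [i] is chosen with probability proportional to [D_i + a], so the mean of the term [2 D_i]
    is [2 (Z + 2 a t)] over the normalization. Using [a < 1] above and dropping [1 + a] below bounds
    it by [2 Z / ((2 + a) t) + 4 / (2 + a)], whose last term is at most 4 because [-1 < a]. *)
Lemma expect_sum_sq_deg_step (t : nat) : a < 1 -> (0 < t)%N ->
  expect (@sum_sq_deg R t.+1) <=
  (1 + 2 / (2 + a) / t%:R) * expect (@sum_sq_deg R t) + 8.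
Proof.
move=> a_lt t0; rewrite expect_step -expect_affine; apply: ler_expect => h.
have t0' : 0 < t%:R :> R by rewrite ltr0n.
have agt : -1 < a := a_gt.
have a20 : 0 < 2 + a by lra.
apply: le_trans (ler_sum _ (fun c _ =>
  ler_wpM2l (attach_prob_ge0 a_gt h c) (sum_sq_deg_step t h c))) _.
under eq_bigr do rewrite mulrDr.
rewrite big_split /= -mulr_suml attach_prob_sum1 // mul1r.
rewrite big_option_ord mulr0 add0r.
set Z := sum_sq_deg h.
have -> : \sum_i attach_prob a (pa1_graph h) (Some i) * (2 * (mdeg (pa1_graph h) i)%:R)
    = 2 * (Z + a * (2 * t%:R)) / (t%:R * (2 + a) + (1 + a)).
  have <- : \sum_i (mdeg (pa1_graph h) i)%:R = 2 * t%:R :> R.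
    by rewrite -natr_sum sum_mdeg size_pa1_graph natrM.
  rewrite /Z /sum_sq_deg [a * _]mulr_sumr -big_split mulr_sumr mulr_suml.
  by apply: eq_bigr => i _ /=; rewrite /attach_prob; ring.
have Z0 : 0 <= Z by apply: sumr_ge0 => i _; exact: sqr_ge0.
have -> : (1 + 2 / (2 + a) / t%:R) * Z + 8 = Z + 4 + (2 / (2 + a) / t%:R * Z + 4) by ring.
rewrite lerD2l.
apply: (@le_trans _ _ (2 * (Z + 2 * t%:R) / (t%:R * (2 + a)))).
  have t20 : 0 < t%:R * (2 + a) by rewrite mulr_gt0.
  apply: (@le_trans _ _ (2 * (Z + 2 * t%:R) / (t%:R * (2 + a) + (1 + a)))).
    by apply: ler_wpM2r; [rewrite invr_ge0; lra | nra].
  apply: ler_wpM2l; first by lra.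
  by rewrite lef_pV2 ?posrE; lra.
have -> : 2 * (Z + 2 * t%:R) / (t%:R * (2 + a)) = 2 / (2 + a) / t%:R * Z + 4 / (2 + a).
  by field; rewrite !gt_eqF.
rewrite lerD2l ler_pdivrMr //; lra.
Qed.

End Expectation.

(** * Edges lost in the simplification *)

Definition redundant (m : nat) {t : nat} (h : history t) (c : option 'I_t) : bool :=
  (t %/ m == target c %/ m)%N || ((t %/ m, target c %/ m)%N \in block_arcs m h).

Lemma lost_step (m t : nat) (h : history t) (c : option 'I_t) :
  @lost m t.+1 (h, c) = (lost m h + redundant m h c)%N.
Proof.
have le_t : (num_arcs (block_arcs m h) <= t)%N.
  by rewrite (leq_trans (num_arcs_size _)) // !size_map size_pa1_graph.
rewrite /lost /block_arcs arc_list_step map_cons num_arcs_cons -/(block_arcs m h).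
by rewrite /redundant /=; case: (_ || _); rewrite /= ?addn0 ?addn1 ?subSS ?subSn.
Qed.

Lemma card_blocks (m t : nat) (s : seq nat) : (0 < m)%N ->
  (#|[set i : 'I_t | (i %/ m)%N \in s]| <= m * size s)%N.
Proof.
move=> m0; elim: s => [|b s IH] /=.
  by rewrite muln0 leqn0 cards_eq0; apply/eqP/setP => i; rewrite !inE.
rewrite mulnS; apply: leq_trans (leq_add (card_block m t b m0) IH).
apply: leq_trans (leq_card_setU _ _); apply: subset_leq_card; apply/subsetP => i.
by rewrite !inE.
Qed.

(** A redundant endpoint is the new vertex, or lies in its block or in a block that this block
    already points to. There are at most [m] of the latter by [count_block_fst], and each block has
    at most [m] vertices. *)
Lemma card_redundant (m t : nat) (h : history t) : (0 < m)%N ->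
  (#|[set c | redundant m h c]| <= 1 + m * m.+1)%N.
Proof.
move=> m0.
pose s := (t %/ m)%N :: [seq p.2 | p <- block_arcs m h & p.1 == (t %/ m)%N].
have size_s : (size s <= m.+1)%N.
  by rewrite /= ltnS size_map size_filter; apply: count_block_fst.
pose T := [set i : 'I_t | (i %/ m)%N \in s].
have sub : [set c | redundant m h c] \subset None |: [set Some i | i in T].
  apply/subsetP => -[i|]; rewrite !inE // => /orP[/eqP ti|ti]; apply/orP; right;
    apply/imsetP; exists i => //; rewrite !inE.
    by rewrite /= -ti eqxx.
  by apply/orP; right; apply/mapP; exists (t %/ m, i %/ m)%N; rewrite // mem_filter eqxx.
apply: leq_trans (subset_leq_card sub) _.
apply: leq_trans (leq_card_setU _ _) _; rewrite cards1 leq_add2l.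
apply: leq_trans (leq_imset_card _ _) _.
by apply: leq_trans (card_blocks m t s m0) _; rewrite leq_mul2l size_s orbT.
Qed.

Section LostArcs.
Context {R : realType} (a : R) (a_gt : -1 < a) (a_lt : a < 1).

(* [D <= eta t + D^2 / (eta t)] bounds every degree by the second moment. *)
Lemma attach_prob_le (t : nat) (h : history t) (c : option 'I_t) (eta : R) :
  (0 < t)%N -> 0 < eta ->
  attach_prob a (pa1_graph h) c
    <= eta^-1 * (sum_sq_deg h / t%:R ^+ 2) + (eta + 2 / t%:R).
Proof.
move=> t0 eta0; have [agt alt] := (a_gt : -1 < a, a_lt : a < 1).
have t0' : 0 < t%:R :> R by rewrite ltr0n.
have den0 : t%:R <= t%:R * (2 + a) + (1 + a) by nra.
have Z0 : 0 <= sum_sq_deg h :> R by apply: sumr_ge0 => i _; exact: sqr_ge0.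
have -> : eta^-1 * (sum_sq_deg h / t%:R ^+ 2) + (eta + 2 / t%:R) =
    (eta * t%:R + sum_sq_deg h / (eta * t%:R) + 2) / t%:R.
  by field; rewrite !gt_eqF.
have et0 : 0 < eta * t%:R by rewrite mulr_gt0.
have num_le : (if c is Some i then (mdeg (pa1_graph h) i)%:R + a else 1 + a)
    <= eta * t%:R + sum_sq_deg h / (eta * t%:R) + 2.
  case: c => [i|]; last first.
    have : 0 <= sum_sq_deg h / (eta * t%:R) by rewrite divr_ge0 // ltW.
    by lra.
  have leZ : (mdeg (pa1_graph h) i)%:R ^+ 2 <= sum_sq_deg h :> R.
    rewrite /sum_sq_deg (bigD1 i) //= lerDl.
    by apply: sumr_ge0 => j _; exact: sqr_ge0.
  set D := (mdeg _ _)%:R in leZ *.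
  suff : D <= eta * t%:R + sum_sq_deg h / (eta * t%:R) by lra.
  rewrite -(ler_pM2r et0) mulrDl divfK ?gt_eqF //.
  set x := eta * t%:R in et0 *; nra.
have num0 : 0 <= if c is Some i then (mdeg (pa1_graph h) i)%:R + a else 1 + a.
  case: c {num_le} => [i|]; last lra.
  have : 1 <= (mdeg (pa1_graph h) i)%:R :> R by rewrite ler1n mdeg_pa1_gt0.
  by lra.
rewrite /attach_prob; apply: ler_pM => //; first by rewrite invr_ge0; lra.
by rewrite lef_pV2 ?posrE //; lra.
Qed.

(** Union bound over the redundant endpoints. The bound of [attach_prob_le] is affine in
    [sum_sq_deg], so it survives taking expectations. *)
Lemma expect_lost_step (m t : nat) (eta : R) : (0 < m)%N -> (0 < t)%N -> 0 < eta ->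
  expect a (fun h : history t.+1 => (lost m h)%:R)
    - expect a (fun h : history t => (lost m h)%:R) <=
  (1 + m * m.+1)%:R
    * (eta^-1 * (expect a (@sum_sq_deg R t) / t%:R ^+ 2) + (eta + 2 / t%:R)).
Proof.
move=> m0 t0 eta0; rewrite lerBlDl expect_step.
set K := (1 + m * m.+1)%N.
have -> : K%:R * (eta^-1 * (expect a (@sum_sq_deg R t) / t%:R ^+ 2) + (eta + 2 / t%:R)) =
  expect a (fun h : history t => K%:R * eta^-1 / t%:R ^+ 2 * sum_sq_deg h
            + K%:R * (eta + 2 / t%:R)).
  by rewrite expect_affine //; ring.
rewrite -expectD; apply: ler_expect => // h.
under eq_bigr do rewrite lost_step natrD mulrDr.
rewrite big_split /= -mulr_suml attach_prob_sum1 // mul1r lerD2l.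
set p := eta^-1 * (sum_sq_deg h / t%:R ^+ 2) + (eta + 2 / t%:R).
have p0 : 0 <= p.
  by apply: le_trans (attach_prob_ge0 a_gt h None) (attach_prob_le _ _ _ _ t0 eta0).
apply: (@le_trans _ _ (\sum_(c in [set c | redundant m h c]) p)).
  rewrite [leRHS]big_mkcond; apply: ler_sum => c _; rewrite inE.
  by case: (redundant m h c); rewrite ?mulr1 ?mulr0 // attach_prob_le.
rewrite sumr_const -[p *+ _]mulr_natl; apply: (@le_trans _ _ (K%:R * p)).
  by rewrite ler_wpM2r // ler_nat card_redundant.
by rewrite le_eqVlt; apply/orP; left; apply/eqP; rewrite /p; ring.
Qed.

Lemma expect_lost_mono (m t : nat) :
  expect a (fun h : history t => (lost m h)%:R)
    <= expect a (fun h : history t.+1 => (lost m h)%:R).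
Proof.
rewrite expect_step; apply: ler_expect => // h.
under eq_bigr do rewrite lost_step natrD mulrDr.
rewrite big_split /= -mulr_suml attach_prob_sum1 // mul1r lerDl.
by apply: sumr_ge0 => c _; rewrite mulr_ge0 // attach_prob_ge0.
Qed.

End LostArcs.

(** * Limits *)

From mathcomp Require Import all_classical all_reals all_analysis.
Import numFieldNormedType.Exports.
Local Open Scope classical_set_scope.
Local Open Scope ring_scope.

Lemma cvg_invn {R : realType} : (n%:R^-1 : R) @[n --> \oo] --> 0.
Proof.
rewrite -(cvg_shiftS (fun n : nat => (n%:R^-1 : R))); exact: cvg_harmonic.
Qed.

(** In substance [(1 + 1 / t)^(-b) >= exp (- b / t) >= 1 - b / t], the first because
    [ln (1 + x) <= x]. *)
Lemma powR_inv_ratio {R : realType} (b : R) (t : nat) : 0 < b -> (0 < t)%N ->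
  t%:R^-1 `^ b * (1 - b / t%:R) <= t.+1%:R^-1 `^ b.
Proof.
move=> b0 t0; have t0' : 0 < t%:R :> R by rewrite ltr0n.
pose x := 1 + t%:R^-1 : R; have x0 : 0 < x by rewrite addr_gt0 ?invr_gt0.
have -> : t.+1%:R^-1 = t%:R^-1 * x^-1 :> R.
  by rewrite /x -natr1; field; rewrite !gt_eqF // addr_gt0.
rewrite powRM ?invr_ge0 ?(ltW t0') ?(ltW x0) // ler_wpM2l ?powR_ge0 //.
rewrite /powR invr_eq0 gt_eqF // lnV ?posrE // mulrN.
apply: le_trans (expR_ge1Dx _); rewrite lerD2l lerN2 ler_pM2l //.
apply: le_ln1Dx; apply: (@lt_trans _ _ 0); rewrite ?invr_gt0 //; lra.
Qed.

Lemma powR_inv_ge {R : realType} (b : R) (t : nat) : 0 < b <= 1 -> (0 < t)%N ->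
  1 <= t%:R * t%:R^-1 `^ b.
Proof.
move=> /andP[b0 b1] t0; have t0' : 0 < t%:R :> R by rewrite ltr0n.
rewrite -ler_pdivrMl // mulr1 -[leLHS]powRr1 ?invr_ge0 ?(ltW t0') //.
rewrite /powR invr_eq0 gt_eqF // ler_expR lnV ?posrE //.
have : 0 <= ln t%:R :> R by rewrite ln_ge0 // ler1n.
nra.
Qed.

(* The witness is [A t^2 t^(-b)] with [0 < b < 2 - theta]. *)
Lemma recurrence_little_o_sqr {R : realType} (z : nat -> R) (theta C : R) :
  0 < theta < 2 -> 0 <= C -> (forall t, 0 <= z t) ->
  (forall t, (0 < t)%N -> z t.+1 <= (1 + theta / t%:R) * z t + C) ->
  z t / t%:R ^+ 2 @[t --> \oo] --> 0.
Proof.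
move=> /andP[th0 th2] C0 z0 rec.
(* The bound [1 / 3] makes [1 - 2 b - b / t] nonnegative; the other one leaves a gap [g > 0] in the
   coefficient of [t]. *)
pose b : R := Num.min (3^-1) ((2 - theta) / 2).
have b0 : 0 < b by rewrite lt_min invr_gt0 ltr0n divr_gt0 // subr_gt0.
have b3 : b <= 3^-1 by rewrite ge_min lexx.
have bth : b <= (2 - theta) / 2 by rewrite ge_min lexx orbT.
pose g := 2 - b - theta; have g0 : 0 < g by rewrite /g; lra.
(* The summand [C / g] absorbs the constant [C] at each step, and [z 1] starts the induction. *)
pose A := C / g + z 1%N.
have A0 : 0 <= A by rewrite addr_ge0 // divr_ge0 // ltW.
have bound t : (0 < t)%N -> z t <= A * (t%:R ^+ 2 * t%:R^-1 `^ b).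
  elim: t => // t IH _; case: (posnP t) => [->|t0].
    by rewrite invr1 powR1 expr1n !mulr1 lerDr divr_ge0 // ltW.
  have t0' : 0 < t%:R :> R by rewrite ltr0n.
  have t1 : 1 <= t%:R :> R by rewrite ler1n.
  set q := t%:R^-1 `^ b in IH; have q0 : 0 <= q by exact: powR_ge0.
  have tq : 1 <= t%:R * q by apply: powR_inv_ge; rewrite // b0; lra.
  have ratio := @powR_inv_ratio R b t b0 t0; rewrite -/q in ratio.
  apply: le_trans (rec t t0) _.
  apply: (@le_trans _ _ (A * ((t%:R + 1) ^+ 2 * (q * (1 - b / t%:R))))); last first.
    by rewrite natr1 ler_wpM2l // ler_wpM2l // sqr_ge0.
  have -> : A * ((t%:R + 1) ^+ 2 * (q * (1 - b / t%:R))) =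
      A * q * (t%:R ^+ 2 + (2 - b) * t%:R + (1 - 2 * b - b / t%:R)).
    by field; rewrite gt_eqF.
  have bt : b / t%:R <= b by rewrite ler_pdivrMr // ler_peMr // ltW.
  have step : (1 + theta / t%:R) * z t <= A * q * (t%:R ^+ 2 + theta * t%:R).
    have -> : A * q * (t%:R ^+ 2 + theta * t%:R) =
        (1 + theta / t%:R) * (A * (t%:R ^+ 2 * q)) by field; rewrite gt_eqF.
    by apply: ler_wpM2l (IH t0); rewrite addr_ge0 // divr_ge0 // ltW.
  have Cle : C <= A * q * (g * t%:R).
    have -> : A * q * (g * t%:R) = (A * g) * (t%:R * q) by ring.
    have AgC : C <= A * g.
      by rewrite /A mulrDl divfK ?gt_eqF // lerDl mulr_ge0 // ltW.
    by apply: le_trans AgC _; rewrite ler_peMr // mulr_ge0 // ltW.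
  have rest : 0 <= A * q * (1 - 2 * b - b / t%:R).
    by rewrite !mulr_ge0 //; lra.
  have -> : A * q * (t%:R ^+ 2 + (2 - b) * t%:R + (1 - 2 * b - b / t%:R)) =
    A * q * (t%:R ^+ 2 + theta * t%:R) + A * q * (g * t%:R)
      + A * q * (1 - 2 * b - b / t%:R) by rewrite /g; ring.
  lra.
apply: (@squeeze_cvgr _ _ _ _ (fun=> 0) (fun t : nat => A * t%:R^-1 `^ b)).
- near=> t; have t0 : (0 < t)%N by near: t; exists 1%N.
  have t0' : 0 < t%:R :> R by rewrite ltr0n.
  rewrite divr_ge0 ?sqr_ge0 //= ler_pdivrMr ?exprn_gt0 //.
  by rewrite -mulrA [_ `^ _ * _]mulrC bound.
- exact: cvg_cst.
rewrite -[X in _ --> X](mulr0 A); apply: cvgM; first exact: cvg_cst.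
(* After the shift every argument is strictly positive, as the sequential form of the limit at 0
   from the right demands. *)
rewrite -(cvg_shiftS (fun t : nat => t%:R^-1 `^ b)).
have /cvg_at_rightP := powR_cvg0 b0; apply; split; last exact: cvg_harmonic.
by move=> n; rewrite /= invr_gt0.
Unshelve. all: by end_near. Qed.

(** The increments telescope, so [x n / n] is their arithmetic mean and Cesaro's theorem applies. *)
Lemma arithmetic_mean_increments {R : realType} (x : nat -> R) :
  x 0%N = 0 -> (x n.+1 - x n) @[n --> \oo] --> 0 -> x n / n%:R @[n --> \oo] --> 0.
Proof.
move=> x0 /cesaro; rewrite -[X in _ -> X](cvg_shiftS (fun n => x n / n%:R)).
apply: cvg_trans; apply: near_eq_cvg; near=> n => /=.
by rewrite /arithmetic_mean /series /= telescope_sumr // x0 subr0 mulrC.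
Unshelve. all: by end_near. Qed.

Section Limits.
Context {R : realType} (s : R) (hs : -1 < s < 1).

Lemma sum_sq_deg_little_o :
  expect s (@sum_sq_deg R t) / t%:R ^+ 2 @[t --> \oo] --> 0.
Proof.
have /andP[s_gt s_lt] := hs.
apply: (@recurrence_little_o_sqr R (fun t => expect s (@sum_sq_deg R t)) (2 / (2 + s)) 8).
- by rewrite divr_gt0 ?ltr_pdivrMr; lra.
- by [].
- move=> t; apply: expect_ge0 => // h.
  by apply: sumr_ge0 => i _; exact: sqr_ge0.
- by move=> t t0; apply: expect_sum_sq_deg_step.
Qed.

(** The one-step increments are nonnegative by [expect_lost_mono] and tend to 0 by
    [expect_lost_step]; hence so do their means. *)
Lemma lost_little_o (m : nat) : (0 < m)%N ->
  expect s (fun h : history t => (lost m h)%:R) / t%:R @[t --> \oo] --> 0.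
Proof.
move=> m0; have /andP[s_gt s_lt] := hs.
pose K : R := (1 + m * m.+1)%:R.
(* The square root balances the two terms of [expect_lost_step]: the rescaled second moment divided
   by [eta] is at most [eta]. The summand [1 / t] keeps [eta] positive. *)
pose eta (t : nat) := Num.sqrt (expect s (@sum_sq_deg R t) / t%:R ^+ 2 + t%:R^-1).
have u0 t : 0 <= expect s (@sum_sq_deg R t) / t%:R ^+ 2.
  rewrite divr_ge0 ?sqr_ge0 // expect_ge0 // => h.
  by apply: sumr_ge0 => i _; exact: sqr_ge0.
have eta_cvg : eta t @[t --> \oo] --> 0.
  rewrite -[X in _ --> X](@sqrtr0 R); apply: continuous_cvg; first exact: sqrt_continuous.
  rewrite -[X in _ --> X](addr0 0); apply: cvgD; first exact: sum_sq_deg_little_o.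
  exact: cvg_invn.
apply: (arithmetic_mean_increments (fun t => expect s (fun h : history t => (lost m h)%:R))).
  by rewrite /expect big1 // => h _; rewrite mulr0.
apply: (@squeeze_cvgr _ _ _ _ (fun=> 0) (fun t : nat => K * (eta t + (eta t + 2 * t%:R^-1)))).
- near=> t; have t0 : (0 < t)%N by near: t; exists 1%N.
  rewrite subr_ge0 expect_lost_mono //=.
  have eta0 : 0 < eta t by rewrite sqrtr_gt0 ltr_wpDl // invr_gt0 ltr0n.
  apply: le_trans (expect_lost_step s s_gt s_lt m t (eta t) m0 t0 eta0) _.
  rewrite ler_wpM2l // lerD2r ler_pdivrMl //.
  rewrite -expr2 sqr_sqrtr ?lerDl ?invr_ge0 //.
  by rewrite addr_ge0 ?invr_ge0.
- exact: cvg_cst.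
rewrite -[X in _ --> X](mulr0 K) -[X in _ --> K * X](addr0 0) -[X in _ --> K * (_ + X)](addr0 0).
rewrite -[X in _ --> K * (_ + (_ + X))](mulr0 2).
apply: cvgM; first exact: cvg_cst.
apply: cvgD => //; apply: cvgD => //; apply: cvgM; first exact: cvg_cst.
exact: cvg_invn.
Unshelve. all: by end_near. Qed.

End Limits.

(** * Markov's inequality and the conclusion *)

Lemma sum_pmf_ge {R : realType} (a : R) (t : nat) (A : pred (history t)) (f : history t -> R) :
  -1 < a -> (forall h, 0 <= f h) -> (forall h, ~~ A h -> 1 <= f h) ->
  1 - expect a f <= \sum_(h | A h) pa1_pmf a h <= 1.
Proof.
move=> a_gt f0 f1; rewrite -(pa1_pmf_sum1 a_gt t) [X in X - _](bigID A) [X in _ <= _ <= X](bigID A) /=.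
apply/andP; split; last by rewrite lerDl sumr_ge0 // => h _; rewrite pa1_pmf_ge0.
rewrite lerBlDr lerD2l big_mkcond; apply: ler_sum => h _.
by case: ifP => [/f1 fh|_]; rewrite ?ler_peMr ?mulr_ge0 ?pa1_pmf_ge0.
Qed.

Theorem theorem4p4 (R : realType) (s : R) (hs : -1 < s < 1) :
  exists2 c' : R, 0 < c' &
  forall m : nat, (0 < m)%N ->
  exists2 eps : nat -> R, eps n @[n --> \oo] --> (0 : R) &
    pa_prob m (s * m%:R)
      (fun G : multigraph 'I_n =>
         (`|avg_degree R (simplify G) - 2 * m%:R| <= 2 * m%:R * eps n)
         && (c' * m%:R `^ (- 2^-1) <= max_modularity R (simplify G)))
      @[n --> \oo] --> (1 : R).
Proof.
exists 128^-1 => // m m0; have /andP[s_gt s_lt] := hs.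
pose r t := expect s (fun h : history t => (lost m h)%:R) / t%:R.
pose u t := expect s (@sum_sq_deg R t) / t%:R ^+ 2.
(* With the square root, more than [eps N] arcs are lost with probability at most [r / eps <= eps];
   the summand [1 / n] keeps [eps] positive. *)
pose eps n := Num.sqrt (r (m * n)%N + n%:R^-1).
have r_cvg : r (m * n)%N @[n --> \oo] --> 0.
  exact: (@cvg_comp _ _ _ (muln m) r _ _ _ (cvg_mulnl _ m0) (lost_little_o s hs m m0)).
have u_cvg : u (m * n)%N @[n --> \oo] --> 0.
  exact: (@cvg_comp _ _ _ (muln m) u _ _ _ (cvg_mulnl _ m0) (sum_sq_deg_little_o s hs)).
have r0 t : 0 <= r t by rewrite divr_ge0 // expect_ge0.
have eps_cvg : eps n @[n --> \oo] --> 0.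
  rewrite -[X in _ --> X](@sqrtr0 R); apply: continuous_cvg; first exact: sqrt_continuous.
  rewrite -[X in _ --> X](addr0 0); apply: cvgD => //; exact: cvg_invn.
exists eps => //.
(* The threshold for the second moment in [max_modularity_pa]. *)
pose eta : R := (81 * 128 * m%:R ^+ 4)^-1.
have m0' : 0 < m%:R :> R by rewrite ltr0n.
have eta0 : 0 < eta by rewrite invr_gt0 pmulr_rgt0 ?exprn_gt0 // mulr_gt0.
have eps_small : \forall n \near \oo, eps n <= 4^-1.
  by apply: (cvgr_le 0) eps_cvg _ _; rewrite invr_gt0.
apply: (@squeeze_cvgr _ _ _ _ (fun n => 1 - (eps n + eta^-1 * u (m * n)%N)) (fun=> 1)); last 2 first.
- rewrite -[X in _ --> X]subr0; apply: cvgB; first exact: cvg_cst.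
  rewrite -[X in _ --> X](addr0 0); apply: cvgD => //.
  rewrite -[X in _ --> X](mulr0 eta^-1); apply: cvgM => //; exact: cvg_cst.
- exact: cvg_cst.
near=> n; have n0 : (0 < n)%N by near: n; exists 1%N.
have eps4 : eps n <= 4^-1 by near: n.
have eps0 : 0 < eps n by rewrite sqrtr_gt0 ltr_wpDl // invr_gt0 ltr0n.
set N := (m * n)%N; have N0 : 0 < N%:R :> R by rewrite ltr0n muln_gt0 m0.
(* Each summand is at least 1 when its condition, few lost arcs or a small second moment, fails. *)
pose f (h : history N) : R := (N%:R * eps n)^-1 * (lost m h)%:R
                              + eta^-1 / N%:R ^+ 2 * sum_sq_deg h.
have Ef : expect s f <= eps n + eta^-1 * u N.
  have -> : expect s f = (eps n)^-1 * r N + eta^-1 * u N.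
    rewrite expectD.
    have scale (k : R) (g : history N -> R) : expect s (fun h => k * g h) = k * expect s g.
      by rewrite -[RHS]addr0 -expect_affine //; congr expect; apply: funext => h; rewrite addr0.
    by rewrite !scale /r /u; field; rewrite !gt_eqF.
  rewrite lerD2r ler_pdivrMl // -expr2 sqr_sqrtr; last by rewrite addr_ge0.
  by rewrite lerDl.
rewrite /pa_prob mulfK ?gt_eqF //.
have Z0 (h : history N) : 0 <= sum_sq_deg h :> R.
  by apply: sumr_ge0 => i _; exact: sqr_ge0.
have f10 (h : history N) : 0 <= (N%:R * eps n)^-1 * (lost m h)%:R.
  by rewrite mulr_ge0 // invr_ge0 mulr_ge0 // ltW.
have f20 (h : history N) : 0 <= eta^-1 / N%:R ^+ 2 * sum_sq_deg h.
  by rewrite mulr_ge0 // divr_ge0 ?sqr_ge0 // invr_ge0 ltW.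
set A := (X in \sum_(h | X h) _).
have [] := andP (@sum_pmf_ge R s N A f s_gt _ _).
- by move=> h; rewrite addr_ge0.
- move=> h; rewrite /A negb_and => notA.
  have [le_lost|gt_lost] := leP (lost m h)%:R (N%:R * eps n); last first.
    rewrite -[1]addr0 lerD // ler_pdivlMl ?mulr_gt0 // mulr1; exact: ltW.
  have [le_Z|gt_Z] := leP (sum_sq_deg h) (eta * N%:R ^+ 2); last first.
    rewrite -[1]add0r lerD // mulrAC -mulrA ler_pdivlMl // mulr1 ler_pdivlMr ?exprn_gt0 //.
    exact: ltW.
  (* Both conditions hold here, and [eps n <= 1 / 4] supplies the bound on lost arcs that the
     modularity claim requires. *)
  exfalso; move: notA; apply/negP; rewrite negb_or !negbK.
  rewrite avg_degree_pa //= powRN powR12_sqrt // max_modularity_pa //.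
  rewrite -(ler_nat R) natrM; move: le_lost; rewrite -/N => le_lost.
  have : N%:R * eps n <= N%:R * 4^-1 by rewrite ler_wpM2l.
  by lra.
move=> lo hi; rewrite hi andbT; apply: le_trans lo; rewrite lerD2l lerN2; exact: Ef.
Unshelve. all: by end_near. Qed.
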